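(* Let $F$ be a field of characteristic $\ell\neq 2$ (possibly $0$), let $V$ be an $F$-vector space of finite dimension $m\geq 2$, and let $f:V\times V\to F$ be a non-degenerate symmetric bilinear form. Then: (1) $M(f)$ is the orthogonal complement to $L(f)$ with respect to the bilinear form $\varphi:\mathfrak{gl}(V)\times\mathfrak{gl}(V)\to F$ given by $\varphi(x,y)=\mathrm{tr}(xy)$. Moreover, there is a basis of $V$ relative to which $f$ has Gram matrix $D=\mathrm{diag}(d_1,\dots,d_m)$ and, relative to this basis, $M(f)$ consists of all $A\in\mathfrak{gl}(m)$ such that $d_iA_{ij}=d_jA_{ji}$ for all $i,j$. Furthermore, $M(f)$ is isomorphic to $S^2(V)$ as an $L(f)$-module. (2) $M(f)\cap\mathfrak{sl}(V)$ consists, relative to the basis in (1), of all matrices $A\in\mathfrak{gl}(m)$ such that $d_iA_{ij}=d_jA_{ji}$ for all $i,j$ and $\mathrm{tr}(A)=0$, and is isomorphic to the kernel of the contraction $L(f)$-epimorphism $S^2(V)\to F$ given by $vw\mapsto f(v,w)$. (3) If $m\geq 4$ and $\ell\nmid m$ then $M(f)\cap\mathfrak{sl}(V)$ is an irreducible $L(f)$-module of dimension $\binom{m+1}{2}-1$. (4) If $m\geq 4$ and $\ell\mid m$ then $(M(f)\cap\mathfrak{sl}(V))/\mathfrak{s}$ is an irreducible $L(f)$-module of dimension $\binom{m+1}{2}-2$. (5) If $m=3$ or $m\geq 5$ then $L(f)$ is a simple Lie algebra, isomorphic to both $\mathfrak{gl}(V)/M(f)$ and $\Lambda^2(V)$ as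 $L(f)$-modules. (6) The following are composition series of the $L(f)$-module $\mathfrak{gl}(V)$: $$0\subset\mathfrak{s}\subset M(f)\cap\mathfrak{sl}(V)\subset M(f)\subset\mathfrak{gl}(V),\quad\text{if }m\geq 4\text{ and }\ell\mid m,$$ $$0\subset M(f)\cap\mathfrak{sl}(V)\subset M(f)\subset\mathfrak{gl}(V),\quad\text{if }m\geq 4\text{ and }\ell\nmid m.$$ In any case, $M(f)/(M(f)\cap\mathfrak{sl}(V))$ is the trivial $L(f)$-module.
   Context: $\mathfrak{gl}(V)$ is the Lie algebra of all endomorphisms of $V$ with bracket $[x,y]=xy-yx$, and $\mathfrak{gl}(m)$ is the Lie algebra of all $m\times m$ matrices over $F$. $L(f)=\{x\in\mathfrak{gl}(V)\mid f(xv,w)=-f(v,xw)\text{ for all }v,w\in V\}$ is a Lie subalgebra of $\mathfrak{gl}(V)$, and $M(f)=\{y\in\mathfrak{gl}(V)\mid f(yv,w)=f(v,yw)\text{ for all }v,w\in V\}$ is an $L(f)$-submodule of $\mathfrak{gl}(V)$, where $L(f)$ acts on $\mathfrak{gl}(V)$ by $x\cdot y=[x,y]$. $\mathfrak{s}$ is the space of scalar operators and $\mathfrak{sl}(V)$ the space of traceless operators. A Lie algebra is simple if its dimension is $>1$ and its only ideals are $0$ and itself. The trivial module is one-dimensional with zero action. $V\otimes V$ is an $L(f)$-module via $x\cdot(v\otimes w)=xv\otimes w+v\otimes xw$; $S^2(V)$ is the symmetric square of $V$ ($vw$ denoting the symmetric product of $v,w\in V$), identified with the submodule of symmetric tensors,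 and $\Lambda^2(V)$ is the exterior square, identified with the submodule spanned by all $v\otimes w-w\otimes v$. Endomorphisms are identified with matrices relative to the chosen basis. When $\ell=0$, $\ell\nmid m$ holds.
   Formalization: In (6), the second series for m=4 is claimed in full only when L(f) is simple (otherwise only up to M(f)): as printed it fails, e.g. for F=Q, D=I_4, where gl(V)/M(f) ≅ L(f)=so(4) is a sum of two 3-dimensional ideals. *)

(* Defs.v *)
From HB Require Import structures.
From mathcomp Require Import all_boot all_order all_algebra.

Set Implicit Arguments.
Unset Strict Implicit.
Unset Printing Implicit Defensive.

Import GRing.Theory.
Local Open Scope ring_scope.

Definition has_characteristic (F : fieldType) (l : nat) : Prop :=
  (l = 0%N /\ [pchar F] =i pred0) \/ l \in [pchar F].

Lemma lfun_linE (F : fieldType) (U W : vectType F) (a : F) (g h : 'Hom(U, W)) u :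
  (a *: g + h) u = a *: g u + h u.
Proof. by rewrite add_lfunE scale_lfunE. Qed.

Section LieSubalgebras.
Variables (F : fieldType) (V : vectType F).

Definition lie_bracket (x y : 'End(V)) : 'End(V) := (x \o y)%VF - (y \o x)%VF.

Lemma lie_bracketE x y v : lie_bracket x y v = x (y v) - y (x v).
Proof. by rewrite /lie_bracket add_lfunE opp_lfunE !comp_lfunE. Qed.

Lemma lie_bracketPl a x x' y :
  lie_bracket (a *: x + x') y = a *: lie_bracket x y + lie_bracket x' y.
Proof.
apply/lfunP => v.
rewrite [RHS]lfun_linE !lie_bracketE !lfun_linE.
by rewrite linearD linearZ scalerBr opprD addrACA.
Qed.

Lemma lie_bracketPr a x y y' :
  lie_bracket x (a *: y + y') = a *: lie_bracket x y + lie_bracket x y'.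
Proof.
apply/lfunP => v.
rewrite [RHS]lfun_linE !lie_bracketE !lfun_linE.
by rewrite linearD linearZ scalerBr opprD addrACA.
Qed.

Record lieSubalg := LieSubalg {
  lie_space :> {vspace 'End(V)};
  lie_closed : forall x y,
    x \in lie_space -> y \in lie_space -> lie_bracket x y \in lie_space }.

Definition lie_mul (L : lieSubalg) (x y : subvs_of L) : subvs_of L :=
  Subvs (lie_closed (subvsP x) (subvsP y)).

Definition lie_ideal (L : lieSubalg) (I : {vspace subvs_of L}) : Prop :=
  forall x y : subvs_of L, y \in I -> lie_mul x y \in I.

Definition lie_simple (L : lieSubalg) : Prop :=
  (1 < \dim {: subvs_of L})%N /\
  (forall I : {vspace subvs_of L}, lie_ideal I -> I = 0%VS \/ I = fullv).

End LieSubalgebras.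

Section LieModules.
Variables (F : fieldType) (V : vectType F) (L : lieSubalg V).

Record lieModule := LieModule {
  mod_space :> vectType F;
  act : subvs_of L -> 'End(mod_space);
  act_linear : linear act;
  act_bracket : forall x y, act (lie_mul x y) = lie_bracket (act x) (act y) }.

Arguments act {l} x.

Record submodule (X : lieModule) := Submodule {
  sub_space :> {vspace X};
  sub_stable : forall x u, u \in sub_space -> act x u \in sub_space }.

Definition irreducible_mod (X : lieModule) : Prop :=
  {:X}%VS != 0%VS /\
  (forall U : submodule X, U = 0%VS :> {vspace X} \/ U = fullv :> {vspace X}).

Record modHom (X Y : lieModule) := ModHom {
  hom_fun :> 'Hom(X, Y);
  hom_act : forall x u, hom_fun (act x u) = act x (hom_fun u) }.

Definition mod_isomorphic (X Y : lieModule) : Prop :=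
  exists g : modHom X Y, bijective g.

Definition mod_epi (X Y : lieModule) (g : modHom X Y) : Prop :=
  limg g = fullv.

Lemma act_projE (X : lieModule) (W : submodule X) x u :
  act x u - act x (daddv_pi W^C W u) \in (W : {vspace X}).
Proof.
rewrite -linearB sub_stable //.
have h : u \in (W^C + W)%VS by rewrite addvC addv_complf memvf.
have c : (W^C :&: W = 0)%VS by rewrite capvC capv_compl.
by rewrite -{1}(daddv_pi_add c h) addrC addKr memv_pi.
Qed.

Section SubMod.
Variables (X : lieModule) (U : submodule X).

Definition sub_act (x : subvs_of L) : 'End(subvs_of U) :=
  linfun (vsproj U \o act x \o vsval).

Lemma vsval_sub_act x u : vsval (sub_act x u) = act x (vsval u).
Proof. by rewrite lfunE /= vsprojK // sub_stable // subvsP. Qed.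

Lemma sub_act_linear : linear sub_act.
Proof.
move=> a x y; apply/lfunP => u; rewrite [RHS]lfun_linE; apply: subvs_inj.
by rewrite linearP /= !vsval_sub_act act_linear lfun_linE.
Qed.

Lemma sub_act_bracket x y :
  sub_act (lie_mul x y) = lie_bracket (sub_act x) (sub_act y).
Proof.
apply/lfunP => u; apply: subvs_inj.
rewrite vsval_sub_act act_bracket !lie_bracketE linearB /=.
by rewrite !vsval_sub_act.
Qed.

Definition sub_mod : lieModule := LieModule sub_act_linear sub_act_bracket.

End SubMod.

(* The quotient space X / W is modelled on the complement W^C: the class of u *)
(* is its component in W^C, so that the class map is onto with kernel W       *)
(* (lemmas quo_class_surj and quo_class_eq0).                                 *)
Section QuoMod.
Variables (X : lieModule) (W : submodule X).

Definition quo_class : 'Hom(X, subvs_of W^C) :=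
  linfun (vsproj W^C \o daddv_pi W^C W).

Let complC : (W^C :&: W = 0)%VS.
Proof. by rewrite capvC capv_compl. Qed.

Let memD u : u \in (W^C + W)%VS.
Proof. by rewrite addvC addv_complf memvf. Qed.

Lemma vsval_quo_class u : vsval (quo_class u) = daddv_pi W^C W u.
Proof. by rewrite lfunE /= vsprojK // memv_pi. Qed.

Lemma quo_class_eq0 u : (quo_class u == 0) = (u \in (W : {vspace X})).
Proof.
rewrite -(inj_eq (@subvs_inj _ _ _)) vsval_quo_class linear0.
apply/eqP/idP => [p0|uW].
  by rewrite -(daddv_pi_add complC (memD u)) p0 add0r memv_pi.
have := daddv_pi_add complC (memD u).
by rewrite [daddv_pi W _ u]daddv_pi_id ?capv_compl // -[RHS]add0r => /addIr.
Qed.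

Lemma quo_classK c : quo_class (vsval c) = c.
Proof.
by apply: subvs_inj; rewrite vsval_quo_class daddv_pi_id ?complC // subvsP.
Qed.

Lemma quo_class_surj c : exists u, c = quo_class u.
Proof. by exists (vsval c); rewrite quo_classK. Qed.

Definition quo_act (x : subvs_of L) : 'End(subvs_of W^C) :=
  linfun (quo_class \o act x \o vsval).

Lemma quo_act_class x u : quo_act x (quo_class u) = quo_class (act x u).
Proof.
rewrite lfunE /= vsval_quo_class; apply/eqP; rewrite eq_sym -subr_eq0 -linearB.
by rewrite quo_class_eq0 act_projE.
Qed.

Lemma quo_act_linear : linear quo_act.
Proof.
move=> a x y; apply/lfunP => c; have [u ->] := quo_class_surj c.
rewrite [RHS]lfun_linE !quo_act_class act_linear lfun_linE.
by rewrite linearP.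
Qed.

Lemma quo_act_bracket x y :
  quo_act (lie_mul x y) = lie_bracket (quo_act x) (quo_act y).
Proof.
apply/lfunP => c; have [u ->] := quo_class_surj c.
by rewrite quo_act_class act_bracket !lie_bracketE linearB /= !quo_act_class.
Qed.

Definition quo_mod : lieModule := LieModule quo_act_linear quo_act_bracket.

End QuoMod.

(* The module U / (U :&: W); only used for W contained in U. *)
Section SubQuo.
Variables (X : lieModule) (U W : submodule X).

Definition sub_restr_space : {vspace sub_mod U} :=
  (linfun (vsval : subvs_of U -> X) @^-1: W)%VS.

Lemma mem_sub_restr (u : sub_mod U) :
  (u \in sub_restr_space) = (vsval u \in (W : {vspace X})).
Proof. by rewrite -memv_preim lfunE. Qed.

Lemma sub_restr_stable (x : subvs_of L) (u : sub_mod U) :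
  u \in sub_restr_space -> act x u \in sub_restr_space.
Proof.
by rewrite !mem_sub_restr (vsval_sub_act x u); apply: sub_stable.
Qed.

Definition sub_restr : submodule (sub_mod U) := Submodule sub_restr_stable.

Definition subquo : lieModule := quo_mod sub_restr.

End SubQuo.

Definition zero_sub (X : lieModule) : submodule X.
Proof.
exists 0%VS => x u; rewrite memv0 => /eqP ->.
by rewrite linear0 mem0v.
Defined.

Definition full_sub (X : lieModule) : submodule X.
Proof. by exists fullv => x u _; rewrite memvf. Defined.

Lemma ker_stable (X Y : lieModule) (g : modHom X Y) x u :
  u \in lker g -> act x u \in lker g.
Proof. by rewrite !memv_ker hom_act => /eqP ->; rewrite linear0. Qed.

Definition ker_sub (X Y : lieModule) (g : modHom X Y) : submodule X :=
  Submodule (@ker_stable X Y g).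

(* comp_chain U [:: U_1; ...; U_k] : U < U_1 < ... < U_k and each successive *)
(* factor U_1 / U, U_2 / U_1, ... is irreducible.                             *)
Fixpoint comp_chain (X : lieModule) (U : submodule X) (c : seq (submodule X)) :
    Prop :=
  if c is W :: c' then
    [/\ (U <= W)%VS, U <> W :> {vspace X}, irreducible_mod (subquo W U)
      & comp_chain W c']
  else True.

Definition composition_series (X : lieModule) (c : seq (submodule X)) : Prop :=
  if c is U :: c' then
    [/\ U = 0%VS :> {vspace X}, comp_chain U c'
      & last U c' = fullv :> {vspace X}]
  else False.

Definition triv_act (x : subvs_of L) : 'End(F^o) := 0.

Lemma triv_act_linear : linear triv_act.
Proof. by move=> a x y; rewrite /triv_act scaler0 addr0. Qed.

Lemma triv_act_bracket x y :
  triv_act (lie_mul x y) = lie_bracket (triv_act x) (triv_act y).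
Proof. by apply/lfunP => u; rewrite lie_bracketE /triv_act !lfunE subr0. Qed.

Definition triv_mod : lieModule := LieModule triv_act_linear triv_act_bracket.

Definition trivial_mod (X : lieModule) : Prop :=
  \dim {:X} = 1%N /\ (forall (x : subvs_of L) (u : X), act x u = 0).

HB.instance Definition _ (x : 'End(V)) :=
  GRing.isLinear.Build F _ _ _ (lie_bracket x) (fun a => lie_bracketPr a x).

Definition gl_act (x : subvs_of L) : 'End('End(V)) :=
  linfun (lie_bracket (vsval x)).

Lemma gl_actE x y : gl_act x y = lie_bracket (vsval x) y.
Proof. by rewrite lfunE. Qed.

Lemma gl_act_linear : linear gl_act.
Proof.
move=> a x y; apply/lfunP => z; rewrite [RHS]lfun_linE !gl_actE.
by rewrite linearP lie_bracketPl.
Qed.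

Lemma lie_jacobi (x y z : 'End(V)) :
  lie_bracket (lie_bracket x y) z =
  lie_bracket x (lie_bracket y z) - lie_bracket y (lie_bracket x z).
Proof.
apply/lfunP => v; rewrite [RHS]add_lfunE opp_lfunE !lie_bracketE.
rewrite [x (_ - _)]linearB [y (_ - _)]linearB ![z (_ - _)]linearB /=.
rewrite (opprB (y (z _))) (opprB (x (z _))) (addrACA (x (y _))).
rewrite (addrACA (y (x _))) -!opprD (addrC (y (z _))).
by rewrite (opprB (y (x _) + _)) subrKA opprB addrACA -opprD.
Qed.

Lemma gl_act_bracket x y :
  gl_act (lie_mul x y) = lie_bracket (gl_act x) (gl_act y).
Proof.
by apply/lfunP => z; rewrite [RHS]lie_bracketE !gl_actE /= lie_jacobi.
Qed.

Definition gl_mod : lieModule := LieModule gl_act_linear gl_act_bracket.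

End LieModules.

Arguments act {F V L l} x.
Arguments gl_mod {F V} L.
Arguments triv_mod {F V} L.
Arguments zero_sub {F V L X}.
Arguments full_sub {F V L X}.

Section Matrices.
Variables (F : fieldType) (V : vectType F).

(* The columns are the coordinates of the images of the basis vectors. *)
Definition end_mx m (e : m.-tuple V) (x : 'End(V)) : 'M[F]_m :=
  \matrix_(i, j) coord e i (x e`_j).

Definition end_tr (x : 'End(V)) : F := \tr (end_mx (vbasis {:V}) x).

Lemma end_mx_comp m (e : m.-tuple V) (x y : 'End(V)) :
  basis_of {:V} e -> end_mx e (x \o y)%VF = end_mx e x *m end_mx e y.
Proof.
move=> eB; apply/matrixP => i j; rewrite !mxE comp_lfunE.
rewrite {1}(coord_basis eB (memvf (y e`_j))) !linear_sum /=.
by apply: eq_bigr => k _; rewrite !linearZ /= !mxE mulrC.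
Qed.

Lemma end_mx_is_linear m (e : m.-tuple V) : linear (end_mx e).
Proof.
by move=> a x y; apply/matrixP => i j; rewrite !mxE lfun_linE linearP.
Qed.

HB.instance Definition _ m (e : m.-tuple V) :=
  GRing.isLinear.Build F _ _ _ (end_mx e) (end_mx_is_linear e).

Definition trace_form (x y : 'End(V)) : F := end_tr (x \o y)%VF.

Lemma end_tr_is_scalar : scalar end_tr.
Proof. by move=> a x y; rewrite /end_tr !linearP. Qed.

HB.instance Definition _ :=
  GRing.isLinear.Build F _ F _ end_tr end_tr_is_scalar.

Lemma end_tr_bracket x y : end_tr (lie_bracket x y) = 0.
Proof.
rewrite /end_tr /lie_bracket !linearB /= !end_mx_comp ?vbasisP //.
by rewrite mxtrace_mulC subrr.
Qed.

Definition sl_space : {vspace 'End(V)} := lker (linfun (end_tr : _ -> F^o)).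

Lemma mem_sl x : (x \in sl_space) = (end_tr x == 0).
Proof. by rewrite memv_ker lfunE. Qed.

Definition scalar_space : {vspace 'End(V)} := <[\1%VF]>%VS.

End Matrices.

Section Forms.
Variables (F : fieldType) (V : vectType F) (f : {symmetric V}).

Definition gram_mx m (e : m.-tuple V) : 'M[F]_m := \matrix_(i, j) f e`_i e`_j.

Let b := vbasis {:V}.

(* adj_defect s x = 0 exactly when x is skew-adjoint for f (if s = 1) or      *)
(* self-adjoint for f (if s = -1); so_space and self_space below are L(f) and *)
(* M(f), see lemmas mem_soP and mem_selfP.                                    *)
Definition adj_defect (s : F) (x : 'End(V)) : 'M[F]_(\dim {:V}) :=
  \matrix_(i, j) (f (x b`_i) b`_j + s * f b`_i (x b`_j)).

Lemma adj_defect_is_linear s : linear (adj_defect s).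
Proof.
move=> a x y; apply/matrixP => i j; rewrite !mxE !lfun_linE.
rewrite linearPl linearPr /= mulrDr (mulrCA s) addrACA mulrDr; congr (_ + _).
Qed.

HB.instance Definition _ s :=
  GRing.isLinear.Build F _ _ _ (adj_defect s) (adj_defect_is_linear s).

Lemma mem_adj_defectP s (x : 'End(V)) :
  reflect (forall v w, f (x v) w + s * f v (x w) = 0)
          (x \in lker (linfun (adj_defect s))).
Proof.
rewrite memv_ker lfunE; apply: (iffP eqP) => [x0 v w|x0]; last first.
  by apply/matrixP => i j; rewrite !mxE x0.
rewrite (coord_vbasis (memvf v)) (coord_vbasis (memvf w)) -/b.
rewrite !(linear_sum x) !linear_sumlz mulr_sumr -big_split big1 //= => i _.
rewrite !linear_sumr mulr_sumr -big_split big1 //= => j _.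
rewrite ![x (_ *: _)]linearZ /= !linearZl_LR !linearZr_LR /=.
have /matrixP/(_ i j) := x0; rewrite !mxE => e0.
by rewrite !(mulrCA s) -!mulrDr e0 !mulr0.
Qed.

Definition so_space : {vspace 'End(V)} := lker (linfun (adj_defect 1)).

Definition self_space : {vspace 'End(V)} := lker (linfun (adj_defect (-1))).

Lemma mem_soP (x : 'End(V)) :
  reflect (forall v w, f (x v) w = - f v (x w)) (x \in so_space).
Proof.
apply: (iffP (mem_adj_defectP _ _)) => h v w.
  by apply/eqP; rewrite -addr_eq0 -[f v _]mul1r h.
by rewrite mul1r h addNr.
Qed.

Lemma mem_selfP (y : 'End(V)) :
  reflect (forall v w, f (y v) w = f v (y w)) (y \in self_space).
Proof.
apply: (iffP (mem_adj_defectP _ _)) => h v w.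
  by apply/eqP; rewrite -subr_eq0 -[f v _]mul1r -mulNr h.
by rewrite mulN1r h subrr.
Qed.

Lemma so_closed x y :
  x \in so_space -> y \in so_space -> lie_bracket x y \in so_space.
Proof.
move=> /mem_soP xL /mem_soP yL; apply/mem_soP => v w.
rewrite !lie_bracketE linearBl linearBr /= !(xL, yL) opprB.
by rewrite !opprK addrC.
Qed.

Definition so_alg : lieSubalg V := LieSubalg so_closed.

Lemma self_stable (x : subvs_of so_alg) (y : gl_mod so_alg) :
  y \in self_space -> act x y \in self_space.
Proof.
move=> /mem_selfP yM; have /mem_soP xL := subvsP x; apply/mem_selfP => v w.
rewrite gl_actE /= !lie_bracketE linearBl linearBr /= !(xL, yM).
by rewrite opprK addrC.
Qed.

Definition self_sub : submodule (gl_mod so_alg) := Submodule self_stable.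

Lemma selfsl_stable (x : subvs_of so_alg) (y : gl_mod so_alg) :
  y \in (self_space :&: sl_space V)%VS ->
  act x y \in (self_space :&: sl_space V)%VS.
Proof.
rewrite !memv_cap => /andP[yM _]; rewrite self_stable //=.
by rewrite gl_actE mem_sl end_tr_bracket.
Qed.

Definition selfsl_sub : submodule (gl_mod so_alg) := Submodule selfsl_stable.

Lemma scalar_stable (x : subvs_of so_alg) (y : gl_mod so_alg) :
  y \in scalar_space V -> act x y \in scalar_space V.
Proof.
case/vlineP => k ->; rewrite gl_actE.
suff -> : lie_bracket (vsval x) (k *: \1%VF) = 0 by rewrite mem0v.
by apply/lfunP => v; rewrite lie_bracketE !scale_lfunE !id_lfunE linearZ subrr lfunE.
Qed.

Definition scalar_sub : submodule (gl_mod so_alg) := Submodule scalar_stable.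

Lemma so_stable (x : subvs_of so_alg) (y : gl_mod so_alg) :
  y \in so_space -> act x y \in so_space.
Proof. by rewrite gl_actE; apply: so_closed; apply: subvsP. Qed.

Definition so_sub : submodule (gl_mod so_alg) := Submodule so_stable.

End Forms.

Section Tensors.
Variables (F : fieldType) (V : vectType F).

Let b := vbasis {:V}.

(* V (x) V is modelled on n x n matrices, b_i (x) b_j being the elementary    *)
(* matrix E_ij; lemma tensor_universal is the universal property.             *)
Definition tensor_sq : vectType F := 'M[F]_(\dim {:V}).

Definition tens (v w : V) : tensor_sq :=
  \matrix_(i, j) (coord (vbasis {:V}) i v * coord (vbasis {:V}) j w).

Lemma tensPl a v v' w : tens (a *: v + v') w = a *: tens v w + tens v' w.
Proof.
by apply/matrixP => i j; rewrite !mxE linearP /= mulrDl mulrA.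
Qed.

Lemma tensPr a v w w' : tens v (a *: w + w') = a *: tens v w + tens v w'.
Proof.
by apply/matrixP => i j; rewrite !mxE linearP /= mulrDr mulrCA.
Qed.

HB.instance Definition _ :=
  bilinear_isBilinear.Build F V V tensor_sq *:%R *:%R tens
    (fun w a v v' => tensPl a v v' w, fun v a w w' => tensPr a v w w').

Definition tensor_ext (W : vectType F) (g : V -> V -> W) (t : tensor_sq) : W :=
  \sum_i \sum_j t i j *: g b`_i b`_j.

Lemma tensor_ext_is_linear (W : vectType F) (g : V -> V -> W) :
  linear (tensor_ext g).
Proof.
move=> a t t'; rewrite /tensor_ext scaler_sumr -big_split; apply: eq_bigr => i _.
rewrite scaler_sumr -big_split; apply: eq_bigr => j _ /=.
by rewrite !mxE scalerDl scalerA.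
Qed.

HB.instance Definition _ (W : vectType F) (g : V -> V -> W) :=
  GRing.isLinear.Build F _ _ _ (tensor_ext g) (tensor_ext_is_linear g).

Lemma tensor_ext_tens (W : vectType F) (g : {bilinear V -> V -> W}) v w :
  tensor_ext g (tens v w) = g v w.
Proof.
rewrite {2}(coord_vbasis (memvf v)) {2}(coord_vbasis (memvf w)) -/b.
rewrite linear_sumlz; apply: eq_bigr => i _.
rewrite linear_sumr; apply: eq_bigr => j _.
by rewrite !mxE linearZl_LR linearZr_LR scalerA.
Qed.

Lemma tensor_basis (t : tensor_sq) :
  t = \sum_i \sum_j t i j *: tens b`_i b`_j.
Proof.
have fb : free b := basis_free (vbasisP _).
rewrite {1}[t]matrix_sum_delta; apply: eq_bigr => i _; apply: eq_bigr => j _.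
congr (_ *: _); apply/matrixP => k l.
by rewrite !mxE !coord_free // -natrM mulnb (eq_sym i) (eq_sym j).
Qed.

Lemma tensor_universal (W : vectType F) (g : {bilinear V -> V -> W}) :
  (forall v w, linfun (tensor_ext g) (tens v w) = g v w) /\
  (forall h : 'Hom(tensor_sq, W),
     (forall v w, h (tens v w) = g v w) -> h = linfun (tensor_ext g)).
Proof.
split=> [v w|h hg]; first by rewrite lfunE; apply: tensor_ext_tens.
apply/lfunP => t; rewrite [RHS]lfunE {1}(tensor_basis t) linear_sum.
apply: eq_bigr => i _; rewrite linear_sum; apply: eq_bigr => j _.
by rewrite linearZ /= hg.
Qed.

Section Action.
Variable L : lieSubalg V.

Definition tens_gen (x : 'End(V)) (v w : V) : tensor_sq :=
  tens (x v) w + tens v (x w).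

Definition tensor_act (x : subvs_of L) : 'End(tensor_sq) :=
  linfun (tensor_ext (tens_gen (vsval x))).

Lemma tens_genPl x a v v' w :
  tens_gen x (a *: v + v') w = a *: tens_gen x v w + tens_gen x v' w.
Proof. by rewrite /tens_gen linearP !tensPl addrACA -scalerDr. Qed.

Lemma tens_genPr x a v w w' :
  tens_gen x v (a *: w + w') = a *: tens_gen x v w + tens_gen x v w'.
Proof. by rewrite /tens_gen linearP !tensPr addrACA -scalerDr. Qed.

HB.instance Definition _ x :=
  bilinear_isBilinear.Build F V V tensor_sq *:%R *:%R (tens_gen x)
    (fun w a v v' => tens_genPl x a v v' w, fun v a w w' => tens_genPr x a v w w').

Lemma tensor_act_tens x v w :
  tensor_act x (tens v w) = tens (vsval x v) w + tens v (vsval x w).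
Proof. by rewrite lfunE; apply: (tensor_ext_tens (tens_gen (vsval x))). Qed.

Lemma tensor_lfunP (W : vectType F) (g h : 'Hom(tensor_sq, W)) :
  (forall v w, g (tens v w) = h (tens v w)) -> g = h.
Proof.
move=> gh; apply/lfunP => t; rewrite (tensor_basis t) !linear_sum.
apply: eq_bigr => i _; rewrite !linear_sum; apply: eq_bigr => j _.
by rewrite !linearZ /= gh.
Qed.

Lemma tensor_act_linear : linear tensor_act.
Proof.
move=> a x y; apply: tensor_lfunP => v w.
rewrite [RHS]lfun_linE !tensor_act_tens linearP /= !lfun_linE.
by rewrite tensPl tensPr addrACA -scalerDr.
Qed.

Lemma tensor_act_bracket x y :
  tensor_act (lie_mul x y) = lie_bracket (tensor_act x) (tensor_act y).
Proof.
apply: tensor_lfunP => v w; rewrite [RHS]lie_bracketE !tensor_act_tens.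
rewrite !(linearD (tensor_act _)) /= !tensor_act_tens /= !lie_bracketE.
rewrite [tens (_ - _) _]linearBl [tens _ (_ - _)]linearBr /=.
set A := tens (_ (_ v)) w; set B := tens (_ (_ v)) w.
set C := tens v (_ (_ w)); set D := tens v (_ (_ w)).
set P := tens (_ v) (_ w); set Q := tens (_ v) (_ w).
rewrite [LHS]addrACA -opprD (addrC Q C) (addrC P D) (addrACA A) (addrACA B).
by rewrite (addrC Q P) [in RHS]opprD [RHS]addrACA subrr addr0.
Qed.

Definition tensor_mod : lieModule L :=
  LieModule tensor_act_linear tensor_act_bracket.

Lemma trmx_tens v w : (tens v w)^T = tens w v.
Proof. by apply/matrixP => i j; rewrite !mxE mulrC. Qed.

Definition flip : 'End(tensor_sq) := linfun (trmx : tensor_sq -> tensor_sq).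

Lemma flip_tens v w : flip (tens v w) = tens w v.
Proof. by rewrite lfunE /= trmx_tens. Qed.

Definition sym2_space : {vspace tensor_mod} := fixedSpace flip.

Lemma flip_act (x : subvs_of L) t : flip (tensor_act x t) = tensor_act x (flip t).
Proof.
rewrite -!comp_lfunE; congr (fun_of_lfun _ t); apply: tensor_lfunP => v w.
by rewrite !comp_lfunE flip_tens !tensor_act_tens linearD /= !flip_tens addrC.
Qed.

Lemma sym2_stable (x : subvs_of L) (t : tensor_mod) :
  t \in sym2_space -> act x t \in sym2_space.
Proof. by move=> /fixedSpaceP tS; apply/fixedSpaceP; rewrite flip_act tS. Qed.

Definition sym2_sub : submodule tensor_mod := Submodule sym2_stable.

Definition sym2_mod : lieModule L := sub_mod sym2_sub.

Lemma sym2_tens v w : tens v w + tens w v \in sym2_space.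
Proof. by apply/fixedSpaceP; rewrite linearD /= !flip_tens addrC. Qed.

(* The image of v (x) w in S^2(V): since the characteristic is not 2, S^2(V)  *)
(* is identified with the symmetric tensors by symmetrization.                *)
Definition sprod (v w : V) : sym2_mod :=
  2^-1 *: Subvs (sym2_tens v w).

(* The span of all v (x) w - w (x) v, by lemma ext2_tens. *)
Definition ext2_space : {vspace tensor_mod} :=
  <<[seq tens v w - tens w v | v <- b, w <- b]>>%VS.

Lemma ext2_tens v w : tens v w - tens w v \in ext2_space.
Proof.
rewrite (coord_vbasis (memvf v)) -/b linear_sumlz linear_sumr -sumrB.
apply: rpred_sum => i _; rewrite (coord_vbasis (memvf w)) -/b.
rewrite linear_sumlz linear_sumr -sumrB; apply: rpred_sum => j _ /=.
rewrite !linearZl_LR !linearZr_LR /= [X in _ - X]scalerA mulrC -scalerA.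
rewrite -!scalerBr !rpredZ // memv_span //.
by apply/allpairsP; exists (b`_i, b`_j); rewrite !mem_nth ?size_tuple.
Qed.

Lemma ext2_stable (x : subvs_of L) (t : tensor_mod) :
  t \in ext2_space -> act x t \in ext2_space.
Proof.
rewrite memv_preim; apply/subvP/span_subvP => _ /allpairsP[[v w] /= [_ _ ->]].
rewrite -memv_preim linearB /= !tensor_act_tens opprD addrACA.
rewrite addrACA -opprD [tens (_ w) _ + _]addrC opprD addrACA.
by rewrite rpredD ?ext2_tens.
Qed.

Definition ext2_sub : submodule tensor_mod := Submodule ext2_stable.

Definition ext2_mod : lieModule L := sub_mod ext2_sub.

End Action.

End Tensors.

Arguments tensor_mod {F} V L.
Arguments sym2_mod {F} V L.
Arguments ext2_mod {F} V L.
Arguments sprod {F V} L v w.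

(* Main.v *)
Require Import Defs.
From HB Require Import structures.
From mathcomp Require Import all_boot all_order all_algebra.
From mathcomp Require Import ring.

(* The map u (x) w |-> f(w, -) u is an L(f)-isomorphism from V (x) V onto      *)
(* gl(V) which carries the symmetric tensors to M(f), the skew ones to L(f),   *)
(* and the contraction f to the trace. In particular the elements              *)
(* x_{u,w} = u (x) w - w (x) u lie in L(f), the elements                       *)
(* y_{u,w} = u (x) w + w (x) u lie in M(f), and bracketing with x in L(f)      *)
(* acts on both by the Leibniz rule. For an orthogonal basis e_i, bracketing   *)
(* with x_{i,j} just exchanges the indices i and j up to nonzero scalars and   *)
(* kills the other indices, so a few brackets isolate a single y_{i,k} (or     *)
(* x_{i,k}) inside any submodule with a nonscalar (resp. nonzero) element;     *)
(* only 2 != 0 and enough indices are needed, whatever the field.              *)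

Set Implicit Arguments.
Unset Strict Implicit.
Unset Printing Implicit Defensive.

Import GRing.Theory.
Local Open Scope ring_scope.

(** In a basis where f is diagonal with nonzero entries, every endomorphism is a combination of the
    operators [rk1], so [tensor_end] is onto gl(V), hence bijective by dimension. Flipping a tensor
    amounts to taking the adjoint for f ([form_tensor_end]), so S^2(V) corresponds to M(f) and the
    exterior square to L(f). As 2 is invertible, gl(V) is the direct sum of L(f) and M(f)
    ([so_self_cap0], [so_self_decomp]). This identifies gl(V)/M(f) with L(f), and the dimensions
    follow by counting ([dim_self_so]).

    Irreducibility rests on two facts about a subspace U of gl(V) stable under L(f). If U contains a
    nonscalar element of M(f) and m is at least 4, then U contains all traceless elements of M(f)
    ([stable_selfsl]). If U is nonzero and inside L(f), and m = 3 or m is at least 5, then U is L(f)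
    ([stable_so]). So a proper submodule of the traceless part of M(f) consists of scalars, and the
    identity is traceless exactly when m vanishes in F. When L(f) is simple, gl(V)/M(f) is
    irreducible, because a subspace between M(f) and gl(V) meets L(f) in an ideal
    ([gl_quo_irreducible]). *)

(** * Rank one operators and their symmetrizations *)

Section RankOne.
Variables (F : fieldType) (V : vectType F) (f : {symmetric V}).

Lemma form_sym u v : f u v = f v u.
Proof. by rewrite hermC expr0 mul1r. Qed.

Lemma form_sumr I (r : seq I) (P : pred I) (a : I -> F) (E : I -> V) v :
  f v (\sum_(i <- r | P i) a i *: E i) = \sum_(i <- r | P i) a i * f v (E i).
Proof.
by rewrite linear_sumr; apply: eq_bigr => i _; rewrite linearZr_LR.
Qed.

Definition rk1_fun (u w v : V) : V := f w v *: u.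

Lemma rk1_fun_is_linear u w : linear (rk1_fun u w).
Proof. by move=> a v v'; rewrite /rk1_fun linearP scalerDl scalerA. Qed.

HB.instance Definition _ u w :=
  GRing.isLinear.Build F _ _ _ (rk1_fun u w) (rk1_fun_is_linear u w).

Definition rk1 (u w : V) : 'End(V) := linfun (rk1_fun u w).

Lemma rk1E u w v : rk1 u w v = f w v *: u.
Proof. by rewrite lfunE. Qed.

Lemma rk1_linearl a u u' w : rk1 (a *: u + u') w = a *: rk1 u w + rk1 u' w.
Proof.
by apply/lfunP => v; rewrite lfun_linE !rk1E scalerDr !scalerA mulrC.
Qed.

Lemma rk1_linearr a u w w' : rk1 u (a *: w + w') = a *: rk1 u w + rk1 u w'.
Proof.
by apply/lfunP => v; rewrite lfun_linE !rk1E linearPl scalerDl scalerA.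
Qed.

HB.instance Definition _ :=
  bilinear_isBilinear.Build F V V 'End(V) *:%R *:%R rk1
    (fun w a u u' => rk1_linearl a u u' w, fun u a w w' => rk1_linearr a u w
      w').

(** Skewness of x turns the term - f(w, x v) u of the bracket into f(x w, v) u. *)
Lemma rk1_bracket x u w : x \in so_space f ->
  lie_bracket x (rk1 u w) = rk1 (x u) w + rk1 u (x w).
Proof.
move=> /mem_soP xL; apply/lfunP => v.
by rewrite lie_bracketE add_lfunE !rk1E linearZ /= xL scaleNr.
Qed.

Lemma end_tr_rk1 u w : end_tr (rk1 u w) = f w u.
Proof.
rewrite /end_tr /mxtrace; under eq_bigr do rewrite mxE rk1E linearZ /= mulrC.
by rewrite -form_sumr -coord_vbasis ?memvf.
Qed.

Fact rks_key : unit. Proof. by []. Qed.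

(* Locked, lest unification see a sum in every rks. *)
Definition rks (s : F) (u w : V) : 'End(V) :=
  locked_with rks_key (rk1 u w + s *: rk1 w u).

Lemma rks_def s u w : rks s u w = rk1 u w + s *: rk1 w u.
Proof. by rewrite /rks unlock. Qed.

Lemma rks_linearl s a u u' w : rks s (a *: u + u') w = a *: rks s u w + rks s
  u' w.
Proof.
rewrite !rks_def rk1_linearl rk1_linearr !scalerDr addrACA; congr (_ + (_ + _)).
by rewrite !scalerA mulrC.
Qed.

Lemma rks_linearr s a u w w' : rks s u (a *: w + w') = a *: rks s u w + rks s
  u w'.
Proof.
rewrite !rks_def rk1_linearl rk1_linearr !scalerDr addrACA; congr (_ + (_ + _)).
by rewrite !scalerA mulrC.
Qed.

HB.instance Definition _ s :=
  bilinear_isBilinear.Build F V V 'End(V) *:%R *:%R (rks s)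
    (fun w a u u' => rks_linearl s a u u' w,
     fun u a w w' => rks_linearr s a u w w').

Lemma rksE s u w v : rks s u w v = f w v *: u + s *: (f u v *: w).
Proof. by rewrite rks_def add_lfunE scale_lfunE !rk1E. Qed.

Lemma rks_bracket s x u w : x \in so_space f ->
  lie_bracket x (rks s u w) = rks s (x u) w + rks s u (x w).
Proof.
move=> xL; rewrite !rks_def linearD linearZ /= !rk1_bracket //.
by rewrite scalerDr [s *: _ + s *: rk1 _ (x u)]addrC addrACA.
Qed.

Lemma rksC s u w : s * s = 1 -> rks s w u = s *: rks s u w.
Proof. by move=> ss; rewrite !rks_def scalerDr scalerA ss scale1r addrC. Qed.

Lemma form_rks s u w v v' :
  f (rks s u w v) v' = f w v * f u v' + s * (f u v * f w v').
Proof. by rewrite rksE linearDl /= !linearZl_LR. Qed.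

Lemma rks_so u w : rks (-1) u w \in so_space f.
Proof.
apply/mem_soP => v v'; rewrite (form_sym v) !form_rks.
by rewrite !mulN1r opprB mulrC [X in _ - X]mulrC.
Qed.

Lemma rks_self u w : rks 1 u w \in self_space f.
Proof.
apply/mem_selfP => v v'; rewrite (form_sym v) !form_rks.
by rewrite !mul1r addrC mulrC [X in _ + X]mulrC.
Qed.

End RankOne.

(** * Brackets of symmetrized rank one operators in an orthogonal basis *)

Section OrthogonalBasis.
Variables (F : fieldType) (V : vectType F) (f : {symmetric V}).
Variables (I : finType) (e : I -> V) (d : I -> F).
Hypothesis orth : forall i j, f (e i) (e j) = d i *+ (i == j).
Hypothesis d_neq0 : forall i, d i != 0.
Hypothesis decomp : forall v, v = \sum_i (f (e i) v / d i) *: e i.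
Hypothesis two_neq0 : 2 != 0 :> F.

Local Notation Y s i j := (rks f s (e i) (e j)).
Local Notation X i j := (Y (-1) i j).

Lemma end_eq_form (A B : 'End(V)) :
  (forall v w, f (A v) w = f (B v) w) -> A = B.
Proof.
move=> AB; apply/lfunP => v; rewrite [LHS]decomp [RHS]decomp.
by apply: eq_bigr => i _; rewrite form_sym AB form_sym.
Qed.

Lemma end_decomp (A : 'End(V)) :
  A = \sum_i \sum_j (f (e i) (A (e j)) / (d i * d j)) *: rk1 f (e i) (e j).
Proof.
apply/lfunP => v; rewrite [LHS]decomp sum_lfunE; apply: eq_bigr => i _.
rewrite sum_lfunE {1}[v]decomp linear_sum linear_sumr mulr_suml scaler_suml.
apply: eq_bigr => j _; rewrite linearZ linearZr_LR /= scale_lfunE rk1E scalerA.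
by congr (_ *: _); rewrite invfM; ring.
Qed.

(** Add to the expansion of A the same expansion with i and j exchanged: the coefficients agree up
    to s, since f(e_j, A e_i) = s f(e_i, A e_j). *)
Lemma end_decomp_sign s (A : 'End(V)) : (forall v w, f (A v) w = s * f v (A
  w)) -> s * s = 1 ->
  2 *: A = \sum_i \sum_j (f (e i) (A (e j)) / (d i * d j)) *: Y s i j.
Proof.
move=> As ss; rewrite mulr2n scalerDl scale1r {2}[A]end_decomp exchange_big /=.
rewrite {1}[A]end_decomp -big_split; apply: eq_bigr => i _ /=.
rewrite -big_split; apply: eq_bigr => j _ /=.
rewrite rks_def scalerDr scalerA; congr (_ + _ *: _).
by rewrite [f (e j) _]form_sym As (mulrC (d j)) -mulrA; apply: mulrC.
Qed.

Definition ad i j : 'End('End(V)) := linfun (lie_bracket (X i j)).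

Lemma adE i j y : ad i j y = lie_bracket (X i j) y.
Proof. by rewrite lfunE. Qed.

Lemma ad_add i j y z : ad i j (y + z) = ad i j y + ad i j z.
Proof. exact: linearD. Qed.

Lemma ad_opp i j y : ad i j (- y) = - ad i j y.
Proof. exact: linearN. Qed.

Lemma ad_scale i j a y : ad i j (a *: y) = a *: ad i j y.
Proof. exact: linearZ. Qed.

Definition adE_linear := (ad_add, ad_opp, ad_scale, fun i j => linear0 (ad i
  j)).

(** For distinct i and j, [X i j] sends e_j to d_j e_i and e_i to - d_i e_j, and kills the other
    basis vectors; the Leibniz rule does the rest. *)
Lemma ad_basis s i j a b :
  ad i j (Y s a b) =
    (d j *+ (j == a)) *: Y s i b - (d i *+ (i == a)) *: Y s j b +
    ((d j *+ (j == b)) *: Y s a i - (d i *+ (i == b)) *: Y s a j).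
Proof.
rewrite adE rks_bracket ?rks_so // !rksE !orth !scaleN1r linearBl linearBr /=.
by rewrite !linearZl_LR !linearZr_LR.
Qed.

(** The index pairs being disjoint, both products of [X i j] and [X k l] vanish. The double bracket
    is thus minus the sum of [X k l] A [X i j] and [X i j] A [X k l], which involves only the
    entries of A between the two pairs. *)
Lemma double_bracket s (A : 'End(V)) i j k l : (forall v w, f (A v) w = s * f
  v (A w)) ->
  i != k -> i != l -> j != k -> j != l ->
  ad k l (ad i j A) =
   f (e i) (A (e k)) *: Y s j l + f (e j) (A (e l)) *: Y s i k
   - f (e j) (A (e k)) *: Y s i l - f (e i) (A (e l)) *: Y s j k.
Proof.
move=> As /negPf ik /negPf il /negPf jk /negPf jl.
have X0 v : X i j (X k l v) = 0.
  rewrite [X k l v]rksE linearD !linearZ /= !rksE !orth ik il jk jl.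
  by rewrite !scale0r !(scaler0, addr0).
have X1 v : X k l (X i j v) = 0.
  rewrite [X i j v]rksE linearD !linearZ /= !rksE !orth.
  by rewrite !(eq_sym k) !(eq_sym l) ik il jk jl !scale0r !(scaler0, addr0).
apply: end_eq_form => v w; rewrite !adE !lie_bracketE [X k l _]linearB /=.
rewrite X0 X1 linear0 sub0r subr0 linearBl linearNl /=.
have fA p : f p (A (X i j v)) = s * f (X i j v) (A p) by rewrite form_sym As.
rewrite !form_rks !{}fA !form_rks [X k l v]rksE linearD !linearZ /=.
rewrite !linearDr !linearZr_LR /= !(add_lfunE, opp_lfunE, scale_lfunE).
rewrite !linearDl /= !linearZl_LR !linearNl /= !form_rks.
ring.
Qed.

(** * Subspaces of gl(V) stable under L(f): isolating one off-diagonal element *)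

Section Stable.
Variable (U : {vspace 'End(V)}).
Hypothesis U_stable : forall x y, x \in so_space f -> y \in U -> lie_bracket x
  y \in U.

Lemma neqF (T : eqType) (a b : T) :
  a != b -> ((a == b) = false) * ((b == a) = false).
Proof. by move=> /negPf ab; split; rewrite ?[b == a]eq_sym. Qed.

Lemma stable_scale a x : a != 0 -> a *: x \in U -> x \in U.
Proof. by move=> a0 aU; rewrite -[x]scale1r -(mulVf a0) -scalerA rpredZ. Qed.

Lemma stable_ad i j y : y \in U -> ad i j y \in U.
Proof. by rewrite adE; apply: U_stable; apply: rks_so. Qed.

(** Bracketing with [X k i] replaces the index i by k, up to the factor d_i. *)
Lemma stable_step s i j k :
  i != j -> k != j -> Y s i j \in U -> Y s k j \in U.
Proof.
case: (eqVneq k i) => [->//|/negPf ki /negPf ij /negPf kj /(stable_ad k i)].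
rewrite ad_basis ki ij kj eqxx mulr1n !mulr0n !scale0r !(addr0, subr0).
exact: stable_scale.
Qed.

(** Indices are changed one at a time by [stable_step]; [rksC] makes both slots accessible. *)
Lemma stable_all s i j : s * s = 1 -> i != j -> Y s i j \in U ->
  forall k l, k != l -> Y s k l \in U.
Proof.
move=> ss ij Uij.
have sym k l : Y s k l \in U -> Y s l k \in U by move=> kl; rewrite rksC
  ?rpredZ.
have gen k l : k != j -> k != l -> Y s k l \in U.
  move=> kj kl; apply/sym/(@stable_step s j) => //; first by rewrite eq_sym.
    by rewrite eq_sym.
  by apply/sym/(stable_step ij).
move=> k l kl; have [kj|kj] := eqVneq k j; last exact: gen.
by apply/sym/gen; rewrite eq_sym // -kj.
Qed.

(* Write a for the matrix of values of f (e _) (A (e _)). The double bracket  *)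
(* ad j l (ad i k A) has coordinates a_ij, a_kl, a_kj, a_il on Y k l, Y i j,   *)
(* Y i l, Y k j; ad i l \o ad k j kills the last two and moves the others to   *)
(* Y i j, Y k l; ad i j then kills Y k l, and ad k i turns the remaining        *)
(* combination of Y i i, Y j j into a_ij times a nonzero multiple of Y i k.     *)
Lemma self_isolate A i j k l : uniq [:: i; j; k; l] -> A \in self_space f ->
  A \in U -> f (e i) (A (e j)) != 0 -> Y 1 i k \in U.
Proof.
rewrite /= !inE !negb_or => /and4P[/and3P[ij ik il] /andP[jk jl] kl _] AM AU
  Aij.
have As v w : f (A v) w = 1 * f v (A w) by rewrite mul1r (mem_selfP _ _ AM).
have := stable_ad j l (stable_ad i k AU).
rewrite (double_bracket As) // ?(eq_sym k) // => /(stable_ad k j)/(stable_ad i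
  l).
rewrite !adE_linear !ad_basis.
rewrite ?eqxx ?(neqF ij, neqF ik, neqF il, neqF jk, neqF jl, neqF kl).
rewrite ?(mulr0n, mulr1n, scale0r, addr0, add0r, subr0, sub0r, oppr0, scaler0).
rewrite !adE_linear !ad_basis.
rewrite ?eqxx ?(neqF ij, neqF ik, neqF il, neqF jk, neqF jl, neqF kl).
rewrite ?(mulr0n, mulr1n, scale0r, addr0, add0r, subr0, sub0r, oppr0, scaler0).
move=> /(stable_ad i j)/(stable_ad k i).
rewrite !adE_linear !ad_basis.
rewrite ?eqxx ?(neqF ij, neqF ik, neqF il, neqF jk, neqF jl, neqF kl).
rewrite ?(mulr0n, mulr1n, scale0r, addr0, add0r, subr0, sub0r, oppr0, scaler0).
rewrite !adE_linear !ad_basis.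
rewrite ?eqxx ?(neqF ij, neqF ik, neqF il, neqF jk, neqF jl, neqF kl).
rewrite ?(mulr0n, mulr1n, scale0r, addr0, add0r, subr0, sub0r, oppr0, scaler0).
rewrite [Y 1 k i]rksC ?mulr1 // scale1r -scalerDl -mulr2n -mulr_natr -scalerA.
move=> /(stable_scale Aij); rewrite memvN.
move=> /(stable_scale (d_neq0 k))/(stable_scale (d_neq0 l)).
by move=> /(stable_scale (d_neq0 j))/(stable_scale (d_neq0 i))/(stable_scale
  two_neq0).
Qed.

Lemma ad_diag A c i j : A \in self_space f -> (forall k, A (e k) = c k *: e k)
  ->
  ad i j A = (c j - c i) *: Y 1 i j.
Proof.
move=> /mem_selfP AM Ac; apply/lfunP => v; rewrite adE lie_bracketE scale_lfunE.
rewrite !rksE -!AM !Ac !linearZl_LR !(linearB, linearD, linearZ) /= !Ac.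
rewrite !scalerA !mul1r ?mulN1r !scalerN !scalerA -!scaleNr addrACA -!scalerDl.
by congr (_ *: _ + _ *: _); ring.
Qed.

Lemma card_exists_notin (s : seq I) : (size s < #|I|)%N -> exists x, x \notin s.
Proof.
move=> sI; apply/existsP; apply: contraLR sI; rewrite negb_exists -leqNgt.
move=> /forallP sI; rewrite cardE; apply: uniq_leq_size; rewrite ?enum_uniq //.
by move=> x _; have := sI x; rewrite negbK.
Qed.

(** A nonscalar A either has a nonzero off-diagonal entry, treated by [self_isolate] with two
    further indices, or is diagonal with two distinct eigenvalues, treated by a single bracket
    ([ad_diag]). *)
Lemma self_offdiag A : (4 <= #|I|)%N -> A \in self_space f -> A \in U ->
  A \notin scalar_space V -> exists i k, i != k /\ Y 1 i k \in U.
Proof.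
move=> I4 AM AU.
have [/existsP[i /existsP[j /andP[ij Aij]]] _|] :=
    boolP [exists i, exists j, (i != j) && (f (e i) (A (e j)) != 0)].
  have [|k] := @card_exists_notin [:: i; j]; first exact: leq_trans I4.
  have [|l] := @card_exists_notin [:: i; j; k]; first exact: leq_trans I4.
  rewrite !inE !negb_or ![k == _]eq_sym ![l == _]eq_sym.
  move=> /and3P[il jl kl] /andP[ik jk]; exists i, k; split=> //.
  by apply: (@self_isolate A i j k l); rewrite //= !inE !negb_or ij ik il jk
    jl kl.
rewrite negb_exists => /forallP A0 nA.
pose c k := f (e k) (A (e k)) / d k.
have Ac k : A (e k) = c k *: e k.
  rewrite [LHS]decomp (bigD1 k) //= big1 ?addr0 // => i ik.
  have := A0 i; rewrite negb_exists => /forallP/(_ k).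
  by rewrite ik negbK => /eqP->; rewrite mul0r scale0r.
have [/existsP[i /existsP[j cij]]|] := boolP [exists i, exists j, c i != c j].
  exists i, j; split; first by apply: contraNneq cij => ->.
  apply: (@stable_scale (c j - c i)); first by rewrite subr_eq0 eq_sym.
  by rewrite -(ad_diag i j AM Ac) stable_ad.
rewrite negb_exists => /forallP cc; case/negP: nA.
have [i0 _] := @card_exists_notin [::] (leq_trans (isT : 0 < 4)%N I4).
apply/vlineP; exists (c i0); apply/lfunP => v; rewrite scale_lfunE id_lfunE.
rewrite [v]decomp linear_sum scaler_sumr; apply: eq_bigr => i _ /=.
rewrite linearZ /= Ac !scalerA mulrC; congr (_ * _ *: _).
by have := cc i0; rewrite negb_exists => /forallP/(_ i); rewrite negbK => /eqP.
Qed.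

Lemma end_tr_basis A : end_tr A = \sum_i f (e i) (A (e i)) / d i.
Proof.
rewrite {1}[A]end_decomp linear_sum; apply: eq_bigr => i _.
rewrite linear_sum (bigD1 i) //= big1 => [|j /negPf ji].
  by rewrite addr0 linearZ /= end_tr_rk1 orth eqxx mulr1n invfM mulrA divfK.
by rewrite linearZ /= end_tr_rk1 orth ji mulr0.
Qed.

(** The bracket of [X i j] with [Y 1 i j] is d_j [Y 1 i i] - d_i [Y 1 j j]. These differences supply
    the diagonal traceless elements. *)
Lemma diag_diff i j : Y 1 i j \in U -> Y 1 i i - (d i / d j) *: Y 1 j j \in U.
Proof.
have [->|ij] := eqVneq i j; first by rewrite divff // scale1r subrr mem0v.
move=> /(stable_ad i j); rewrite ad_basis (eq_sym j) (negPf ij) !eqxx.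
rewrite ?(mulr0n, mulr1n, scale0r, addr0, add0r, subr0, sub0r) => h.
apply: (stable_scale (d_neq0 j)).
by rewrite scalerBr scalerA mulrCA divff // mulr1 addrC.
Qed.

Lemma stable_selfsl A : (4 <= #|I|)%N -> A \in self_space f -> A \in U ->
  A \notin scalar_space V -> (self_space f :&: sl_space V <= U)%VS.
Proof.
move=> I4 AM AU /(self_offdiag I4 AM AU)[i0 [k0 [ik0 Uik]]].
have UY := stable_all (mulr1 1) ik0 Uik.
apply/subvP => B; rewrite memv_cap mem_sl => /andP[/mem_selfP BM /eqP trB].
apply: (stable_scale two_neq0); rewrite (@end_decomp_sign 1) ?mulr1 //; last
  first.
  by move=> v w; rewrite mul1r.
(* As tr B = 0, a multiple of [Y 1 i0 i0] by tr B / d_i0 may be subtracted; spread over the diagonal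
   terms, it makes each of them traceless. *)
have -> : \sum_i \sum_j (f (e i) (B (e j)) / (d i * d j)) *: Y 1 i j =
    \sum_i (\sum_(j | j != i) (f (e i) (B (e j)) / (d i * d j)) *: Y 1 i j +
      (f (e i) (B (e i)) / (d i * d i)) *: (Y 1 i i - (d i / d i0) *: Y 1 i0
        i0)).
  transitivity ((\sum_i \sum_j (f (e i) (B (e j)) / (d i * d j)) *: Y 1 i j) -
      (end_tr B / d i0) *: Y 1 i0 i0).
    by rewrite trB mul0r scale0r subr0.
  rewrite end_tr_basis mulr_suml scaler_suml -sumrB; apply: eq_bigr => i _.
  rewrite (bigD1 i) //= scalerBr scalerA addrA (addrC (_ *: Y 1 i i)).
  congr (_ - _ *: _).
  by rewrite invfM !mulrA divfK.
apply: rpred_sum => i _; apply: rpredD; last first.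
  apply/rpredZ; have [->|ii0] := eqVneq i i0; first by rewrite divff //
    scale1r subrr mem0v.
  by apply: diag_diff; apply: UY.
by apply: rpred_sum => j ji; apply/rpredZ/UY; rewrite eq_sym.
Qed.

(** After the double bracket, the fresh index p separates the four terms: [ad l p] keeps only those
    containing l, turning them into [Y (-1) k p] and [Y (-1) i p]. Then [ad k j] kills the latter
    and leaves f(e_i, A e_j) times a nonzero multiple of [Y (-1) j p]. *)
Lemma so_isolate5 A i j k l p : uniq [:: i; j; k; l; p] -> A \in so_space f ->
  A \in U -> f (e i) (A (e j)) != 0 -> Y (-1) j p \in U.
Proof.
rewrite /= !inE !negb_or => /and5P[/and4P[ij ik il ip] /and3P[jk jl jp]].
move=> /andP[kl kp] lp _ AL AU Aij.
have As v w : f (A v) w = -1 * f v (A w) by rewrite mulN1r (mem_soP _ _ AL).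
have := stable_ad j l (stable_ad i k AU).
rewrite (double_bracket As) // ?(eq_sym k) // => /(stable_ad l p).
rewrite !adE_linear !ad_basis.
rewrite ?eqxx ?(neqF ij, neqF ik, neqF il, neqF jk, neqF jl, neqF kl).
rewrite ?(neqF ip, neqF jp, neqF kp, neqF lp).
rewrite ?(mulr0n, mulr1n, scale0r, addr0, add0r, subr0, sub0r, oppr0, scaler0).
move=> /(stable_ad k j).
rewrite !adE_linear !ad_basis.
rewrite ?eqxx ?(neqF ij, neqF ik, neqF il, neqF jk, neqF jl, neqF kl).
rewrite ?(neqF ip, neqF jp, neqF kp, neqF lp).
rewrite ?(mulr0n, mulr1n, scale0r, addr0, add0r, subr0, sub0r, oppr0, scaler0).
rewrite !scalerN opprK.
by move=> /(stable_scale Aij)/(stable_scale (d_neq0 l))/(stable_scale (d_neq0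
  k)).
Qed.

Lemma big_three (E : I -> 'End(V)) i j k : uniq [:: i; j; k] -> #|I| = 3%N ->
  \sum_a E a = E i + (E j + E k).
Proof.
move=> u I3; have -> : E i + (E j + E k) = \sum_(a <- [:: i; j; k]) E a.
  by rewrite !big_cons big_nil addr0.
rewrite [RHS]big_uniq //; apply: eq_bigl => a; apply/esym.
by apply: (subset_cardP _ (subset_predT _)); rewrite (card_uniqP u) I3.
Qed.

(** L(f) is spanned by the elements of index pairs ij, ik and jk. [ad i k] kills the second,
    [ad i j] kills the image of the third, and the first ends up at a nonzero multiple of the
    element of index pair ik. *)
Lemma so_isolate3 A i j k : uniq [:: i; j; k] -> #|I| = 3%N ->
  A \in so_space f -> A \in U -> f (e i) (A (e j)) != 0 -> Y (-1) i k \in U.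
Proof.
move=> u I3 AL AU Aij.
have Yd a : Y (-1) a a = 0 by rewrite rks_def scaleN1r subrr.
have Yo a b : Y (-1) a b = - Y (-1) b a by rewrite rksC ?mulrNN ?mulr1 //
  scaleN1r.
have As v w : f (A v) w = -1 * f v (A w) by rewrite mulN1r (mem_soP _ _ AL).
have := stable_ad i j (stable_ad i k (memvZ 2 AU)).
rewrite (end_decomp_sign As) ?mulrNN ?mulr1 // !(big_three _ u) // !Yd.
move: u; rewrite /= !inE !negb_or => /and3P[/andP[ij ik] jk _].
rewrite (Yo j i) (Yo k i) (Yo k j) !scaler0.
rewrite !adE_linear !ad_basis.
rewrite ?eqxx ?(neqF ij, neqF ik, neqF jk).
rewrite ?(mulr0n, mulr1n, scale0r, addr0, add0r, subr0, sub0r, oppr0, scaler0).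
rewrite !adE_linear !ad_basis.
rewrite ?eqxx ?(neqF ij, neqF ik, neqF jk).
rewrite ?(mulr0n, mulr1n, scale0r, addr0, add0r, subr0, sub0r, oppr0, scaler0).
(* By skewness the contributions of (i, j) and (j, i) add up to twice one of them instead of
   cancelling. *)
have -> : f (e j) (A (e i)) = - f (e i) (A (e j)).
  by rewrite form_sym As mulN1r.
rewrite !Yd (Yo j i) (Yo k i) !(scalerN, opprK, subrr, scaler0, addr0, oppr0).
rewrite !scalerA -scalerBl => /stable_scale; apply.
rewrite (mulrC (d j)) !mulNr opprK -mulrA divfK ?mulf_neq0 //.
by rewrite -mulr2n -mulr_natl mulf_neq0.
Qed.

(** A skew-adjoint A has zero diagonal entries because 2 is nonzero, so a nonzero one has a nonzero
    off-diagonal entry to start the isolation; [stable_all] then yields a spanning set of L(f). *)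
Lemma stable_so A : #|I| = 3%N \/ (5 <= #|I|)%N -> (U <= so_space f)%VS ->
  A \in U -> A != 0 -> U = so_space f.
Proof.
move=> I35 Uso AU A0; have AL := subvP Uso _ AU.
have As v w : f (A v) w = -1 * f v (A w) by rewrite mulN1r (mem_soP _ _ AL).
have [i [j Aij]] : exists i, exists j, f (e i) (A (e j)) != 0.
  have [/existsP[i /existsP[j Aij]]|] :=
    boolP [exists i, exists j, f (e i) (A (e j)) != 0]; first by exists i, j.
  rewrite negb_exists => /forallP A00; case/eqP: A0.
  rewrite [A]end_decomp big1 // => i _; rewrite big1 // => j _.
  have := A00 i; rewrite negb_exists => /forallP/(_ j).
  by rewrite negbK => /eqP->; rewrite mul0r scale0r.
have ij : i != j.
  apply: contraNneq Aij => ij; rewrite -ij; have := As (e i) (e i).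
  rewrite form_sym mulN1r => /eqP; rewrite -addr_eq0 -mulr2n -mulr_natl.
  by rewrite mulf_eq0 (negPf two_neq0).
have [i1 [k1 [ik1 Uik]]] : exists i1 k1, i1 != k1 /\ Y (-1) i1 k1 \in U.
  have I3 : (3 <= #|I|)%N by case: I35 => [->//|]; apply: leq_trans.
  have [k] := @card_exists_notin [:: i; j] I3.
  rewrite !inE !negb_or ![k == _]eq_sym => /andP[ik jk].
  case: I35 => [I3'|I5].
    exists i, k; split=> //; apply: (@so_isolate3 A i j k) => //.
    by rewrite /= !inE !negb_or ij ik jk.
  have [l] := @card_exists_notin [:: i; j; k] (leq_trans (isT : 4 <= 5)%N I5).
  have [p] := @card_exists_notin [:: i; j; k; l] I5.
  rewrite !inE !negb_or ![l == _]eq_sym ![p == _]eq_sym.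
  move=> /and4P[ip jp kp lp] /and3P[il jl kl].
  exists j, p; split=> //; apply: (@so_isolate5 A i j k l p) => //.
  by rewrite /= !inE !negb_or ij ik il ip jk jl jp kl kp lp.
have NN1 : -1 * -1 = 1 :> F by rewrite mulrNN mulr1.
have UY := stable_all NN1 ik1 Uik.
apply/eqP; rewrite eqEsubv Uso; apply/subvP => B /mem_soP BL.
apply: (stable_scale two_neq0); rewrite (@end_decomp_sign (-1)) ?mulrNN ?mulr1
  //; last first.
  by move=> v w; rewrite mulN1r.
apply: rpred_sum => a _; apply: rpred_sum => b _; apply: rpredZ.
have [->|] := eqVneq a b; last exact: UY.
by rewrite rks_def scaleN1r subrr mem0v.
Qed.

End Stable.

End OrthogonalBasis.

(** * Existence of an orthogonal basis *)

Section OrthogonalBasisExistence.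
Variables (F : fieldType) (V : vectType F) (f : {symmetric V}).
Hypothesis two_neq0 : 2 != 0 :> F.

(** Polarization: if x and y are isotropic, then f(x + y, x + y) = 2 f(x, y). *)
Lemma anisotropic_vector (U : {vspace V}) x y :
  x \in U -> y \in U -> f x y != 0 -> exists2 u, u \in U & f u u != 0.
Proof.
move=> xU yU xy; have [xx|] := eqVneq (f x x) 0; last by exists x.
have [yy|] := eqVneq (f y y) 0; last by exists y.
exists (x + y); first exact: rpredD.
rewrite linearDl !linearDr /= xx yy (form_sym f y x) add0r addr0.
by rewrite -mulr2n -mulr_natl mulf_neq0.
Qed.

(** Induction on dim U. If f vanishes on U, any basis will do; otherwise U splits as the line of an
    anisotropic u plus the orthogonal of u in U. The form may be degenerate here. *)
Lemma orthogonal_basis_seq (U : {vspace V}) : exists e : seq V,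
  basis_of U e /\ pairwise (fun x y => f x y == 0) e.
Proof.
have [n] := ubnP (\dim U); elim: n => // n IHn in U *; rewrite ltnS => dimU.
have [b0|] := boolP (all (fun x => all (fun y => f x y == 0) (vbasis U))
  (vbasis U)).
  exists (vbasis U); split; first exact: vbasisP.
  apply/(pairwiseP 0) => i j; rewrite !inE => ib jb _.
  exact: (allP (allP b0 _ (mem_nth 0 ib)) _ (mem_nth 0 jb)).
case/allPn => x xb /allPn[y yb xy].
have [u uU uu] := anisotropic_vector (vbasis_mem xb) (vbasis_mem yb) xy.
pose W := (U :&: orthov f <[u]>)%VS.
have WU : (W <= U)%VS by apply: capvSl.
have uW : u \notin W by rewrite memv_cap mem_orthov1 (negPf uu) andbF.
have [|e [eW eo]] := IHn W.
  apply: leq_trans dimU; rewrite ltn_neqAle dimvS // andbT.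
  by apply: contraNneq uW => dW; have/eqP-> : W == U by rewrite eqEdim WU dW
    leqnn.
exists (u :: e); split; last first.
  rewrite pairwise_cons eo andbT; apply/allP => v /(basis_mem eW).
  by rewrite memv_cap mem_orthov1 form_sym => /andP[].
rewrite /basis_of span_cons free_cons (span_basis eW) uW (basis_free eW) !andbT.
rewrite eqEsubv subv_add -memvE uU WU /=; apply/subvP => v vU.
rewrite -[v](subrKC ((f u v / f u u) *: u)); apply: memv_add.
  by rewrite memvZ ?memv_line.
rewrite memv_cap rpredB ?rpredZ // mem_orthov1 linearBl /= linearZl_LR /=
  (form_sym f v).
by rewrite divfK ?subrr.
Qed.

Lemma orthogonal_basis : exists e : (\dim {:V}).-tuple V,
  basis_of {:V} e /\ forall i j : 'I_(\dim {:V}), i != j -> f e`_i e`_j = 0.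
Proof.
have [e [eB eo]] := orthogonal_basis_seq fullv.
have se : size e == \dim {:V} by rewrite (size_basis (X := in_tuple e) eB).
exists (Tuple se); split=> // i j; rewrite neq_ltn => /orP[] ij.
  by apply/eqP/(pairwiseP 0 eo) => //; rewrite inE (eqP se).
by rewrite form_sym; apply/eqP/(pairwiseP 0 eo) => //; rewrite inE (eqP se).
Qed.

End OrthogonalBasisExistence.

(** * Irreducibility of submodules and quotients; module isomorphisms *)

Section Modules.
Variables (F : fieldType) (V : vectType F) (L : lieSubalg V).
Implicit Types X Y : lieModule L.

(** Unbundled stability: submodules of sub, quotient and subquotient modules can then be tested as
    plain subspaces of X, through images under [vsval] and preimages under [quo_class]. *)
Definition stable X (S : {vspace X}) : Prop :=
  forall (x : subvs_of L) u, u \in S -> act x u \in S.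

Lemma sub_mod_irreducible X (U : submodule X) : U <> 0%VS :> {vspace X} ->
  (forall S : {vspace X}, stable S -> (S <= U)%VS -> S = 0%VS \/ S = U) ->
  irreducible_mod (sub_mod U).
Proof.
move=> U0 Uirr; split.
  rewrite -dimv_eq0 dimvf; apply/eqP => dU; apply: U0; apply/eqP.
  by rewrite -dimv_eq0; apply/eqP.
move=> T; pose S := (linfun (vsval : subvs_of U -> X) @: T)%VS.
have memS u : (vsval u \in S) = (u \in (T : {vspace _})).
  apply/idP/idP => [/memv_imgP[v vT]|uT].
    by rewrite lfunE /= => /subvs_inj ->.
  by apply/memv_imgP; exists u; rewrite ?lfunE.
have SU : (S <= U)%VS.
  by apply/subvP => _ /memv_imgP[v _ ->]; rewrite lfunE subvsP.
have Sst : stable S.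
  move=> x _ /memv_imgP[v vT ->]; rewrite lfunE /= -(vsval_sub_act x v) memS.
  exact: (@sub_stable _ _ _ (sub_mod U) T x v vT).
have [S0|SU'] := Uirr S Sst SU; [left|right]; apply/vspaceP => u.
  by rewrite -memS S0 !memv0 -(inj_eq (@subvs_inj _ _ _)) linear0.
by rewrite -memS SU' subvsP memvf.
Qed.

Lemma quo_mod_irreducible X (W : submodule X) : W <> fullv :> {vspace X} ->
  (forall S : {vspace X}, stable S -> (W <= S)%VS -> S = W \/ S = fullv) ->
  irreducible_mod (quo_mod W).
Proof.
move=> WX Wirr; split.
  rewrite -dimv_eq0 dimvf; apply/eqP => dW; apply: WX; apply/eqP.
  rewrite eqEsubv subvf; apply/subvP => u _; rewrite -quo_class_eq0.
  have : quo_class W u \in {:subvs_of W^C}%VS by apply: memvf.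
  have/eqP : \dim {:subvs_of W^C} = 0%N by rewrite dimvf.
  by rewrite dimv_eq0 => /eqP->; rewrite memv0.
move=> T; pose S := (quo_class W @^-1: T)%VS.
have memS u : (u \in S) = (quo_class W u \in (T : {vspace _})).
  by rewrite -memv_preim.
have Sst : stable S.
  by move=> x u; rewrite !memS -(quo_act_class _ x u) => uT;
  apply: (@sub_stable _ _ _ (quo_mod W) T x _ uT).
have WS : (W <= S)%VS.
  by apply/subvP => u; rewrite memS -quo_class_eq0 => /eqP ->; rewrite mem0v.
have [SW|S1] := Wirr S Sst WS; [left|right]; apply/vspaceP => c;
  have [u ->] := quo_class_surj c; rewrite -memS.
  by rewrite SW memv0 quo_class_eq0.
by rewrite S1 !memvf.
Qed.

Lemma subquo_irreducible X (U W : submodule X) :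
  (W <= U)%VS -> W <> U :> {vspace X} ->
  (forall S : {vspace X}, stable S -> (W <= S)%VS -> (S <= U)%VS -> S = W \/ S
    = U) ->
  irreducible_mod (subquo U W).
Proof.
move=> WU WnU UWirr.
have memR (u : sub_mod U) : (u \in (sub_restr U W : {vspace _})) = (vsval u
  \in (W : {vspace X})).
  exact: mem_sub_restr.
apply: quo_mod_irreducible => [R1|S Sst WS].
  apply: WnU; apply/eqP; rewrite eqEsubv WU; apply/subvP => u uU.
  by rewrite -[u]/(vsval (Subvs uU)) -memR R1 memvf.
pose S' := (linfun (vsval : subvs_of U -> X) @: S)%VS.
have memS u : (vsval u \in S') = (u \in S).
  apply/idP/idP => [/memv_imgP[v vS]|uS].
    by rewrite lfunE /= => /subvs_inj ->.
  by apply/memv_imgP; exists u; rewrite ?lfunE.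
have SU : (S' <= U)%VS.
  by apply/subvP => _ /memv_imgP[v _ ->]; rewrite lfunE subvsP.
have Sst' : stable S'.
  move=> x _ /memv_imgP[v vS ->]; rewrite lfunE /= -(vsval_sub_act x v) memS.
  exact: (Sst x v vS).
have WS' : (W <= S')%VS.
  apply/subvP => u uW; have uU := subvP WU _ uW.
  by rewrite -[u]/(vsval (Subvs uU)) memS (subvP WS) // memR.
have [SW|S1] := UWirr S' Sst' WS' SU; [left|right]; apply/vspaceP => u.
  by rewrite memR -memS SW.
by rewrite -memS S1 subvsP memvf.
Qed.

Lemma dim_sub_mod X (U : submodule X) : \dim {:sub_mod U} = \dim U.
Proof. by rewrite dimvf. Qed.

Lemma dim_subquo X (U W : submodule X) : (W <= U)%VS ->
  \dim {:subquo U W} = (\dim U - \dim W)%N.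
Proof.
move=> WU; rewrite dimvf /= [LHS]dimv_compl dimvf; congr (_ - _)%N.
rewrite -(limg_dim_eq (f := linfun (vsval : subvs_of U -> X))); last first.
  apply/eqP; rewrite -subv0; apply/subvP => u; rewrite memv_cap memv_ker lfunE.
  by move=> /andP[_ /eqP u0]; rewrite memv0 -(inj_eq (@subvs_inj _ _ _))
    linear0 u0.
congr (\dim _); apply/vspaceP => u; apply/memv_imgP/idP => [[v vR ->]|uW].
  by rewrite lfunE -mem_sub_restr.
exists (Subvs (subvP WU _ uW)); last by rewrite lfunE.
by rewrite mem_sub_restr.
Qed.

Lemma line_irreducible X (U W : submodule X) : (W <= U)%VS ->
  \dim U = (\dim W).+1 -> irreducible_mod (subquo U W).
Proof.
move=> WU dU; apply: subquo_irreducible => // [WU'|S _ WS SU].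
  by move: dU; rewrite WU' => /eqP; rewrite (ltn_eqF (ltnSn _)).
have := dimvS SU; rewrite dU leq_eqVlt => /orP[/eqP dS|].
  by right; apply/eqP; rewrite eqEdim SU dU dS leqnn.
by rewrite ltnS => dS; left; apply/eqP; rewrite eq_sym eqEdim WS.
Qed.

(** The strict inclusion that [comp_chain] demands is automatic, since an irreducible factor is
    nonzero. *)
Lemma comp_chain_cons X (W U : submodule X) c : (W <= U)%VS ->
  irreducible_mod (subquo U W) -> comp_chain U c -> comp_chain W (U :: c).
Proof.
move=> WU irr Uc; split=> // WE; case: irr => + _; rewrite -dimv_eq0
  dim_subquo //.
by rewrite WE subnn.
Qed.

Lemma modHom_bij X Y (g : modHom X Y) :
  injective g -> (forall y, exists x, g x = y) -> bijective g.
Proof.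
move=> gi gs; have k0 : lker g == 0%VS by apply/lker0P.
exists (g^-1)%VF; first exact: lker0_lfunK.
by move=> y; have [x <-] := gs y; rewrite lker0_lfunK.
Qed.

Lemma mod_isomorphic_sym X Y : mod_isomorphic X Y -> mod_isomorphic Y X.
Proof.
case=> g gb; have k0 : lker g == 0%VS by apply/lker0P/bij_inj.
have gK : cancel g (g^-1)%VF by apply: lker0_lfunK.
have gV : cancel (g^-1)%VF g.
  by case: gb => h hK Kh y; rewrite -[y]Kh gK.
have hA x u : (g^-1)%VF (act x u) = act x ((g^-1)%VF u).
  by apply: (can_inj gK); rewrite gV hom_act gV.
by exists (ModHom hA), g.
Qed.

Lemma incl_act X (U : submodule X) x (u : sub_mod U) :
  linfun (vsval : subvs_of U -> X) (act x u) =
  act x (linfun (vsval : subvs_of U -> X) u).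
Proof. by rewrite lfunE [in RHS]lfunE /=; apply: vsval_sub_act. Qed.

Definition incl X (U : submodule X) : modHom (sub_mod U) X :=
  ModHom (@incl_act X U).

Lemma inclE X (U : submodule X) (u : sub_mod U) : incl U u = vsval u.
Proof. by rewrite lfunE. Qed.

Lemma comp_hom_act X Y Z (h : modHom Y Z) (g : modHom X Y) x u :
  (h \o g)%VF (act x u) = act x ((h \o g)%VF u).
Proof. by rewrite !comp_lfunE !hom_act. Qed.

Definition comp_hom X Y Z (h : modHom Y Z) (g : modHom X Y) : modHom X Z :=
  ModHom (comp_hom_act h g).

Lemma mod_isomorphic_onto X Y (g : modHom X Y) (W : submodule Y) :
  injective g -> (forall y, y \in (W : {vspace Y}) <-> exists x, g x = y) ->
  mod_isomorphic X (sub_mod W).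
Proof.
move=> gi gW; pose h := linfun (vsproj W \o g) : 'Hom(X, sub_mod W).
have hE u : vsval (h u) = g u.
  by rewrite lfunE /= vsprojK //; apply/gW; exists u.
have hA x u : h (act x u) = act x (h u).
  by apply: subvs_inj; rewrite hE hom_act (vsval_sub_act x (h u)) hE.
exists (ModHom hA); apply: modHom_bij => /= [u v /(congr1 vsval)|w].
  by rewrite !hE => /gi.
have /gW[u gu] := subvsP w.
by exists u; apply: subvs_inj; rewrite hE.
Qed.

End Modules.

(** * The isomorphism of the tensor square with gl(V), and what it identifies *)

Section TensorIso.
Variables (F : fieldType) (V : vectType F) (f : {symmetric V}).
Variables (I : finType) (e : I -> V) (d : I -> F).
Hypothesis orth : forall i j, f (e i) (e j) = d i *+ (i == j).
Hypothesis d_neq0 : forall i, d i != 0.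
Hypothesis decomp : forall v, v = \sum_i (f (e i) v / d i) *: e i.
Hypothesis two_neq0 : 2 != 0 :> F.

Local Notation L := (so_alg f).
Local Notation Y s i j := (rks f s (e i) (e j)).

Lemma halve (W : lmodType F) (u : W) : u = 2^-1 *: (u + u).
Proof. by rewrite -mulr2n -scaler_nat scalerA mulVf // scale1r. Qed.

Lemma eq_oppr0 (W : lmodType F) (u : W) : u = - u -> u = 0.
Proof. by move=> uN; rewrite [u]halve {2}uN subrr scaler0. Qed.

Lemma so_self_cap0 (A : 'End(V)) : A \in so_space f -> A \in self_space f -> A
  = 0.
Proof.
move=> /mem_soP AL /mem_selfP AM; apply: (end_eq_form decomp) => v w.
by rewrite zero_lfunE linear0l; apply: (@eq_oppr0 F^o); rewrite {1}AL -AM.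
Qed.

Lemma so_self_decomp (A : 'End(V)) : exists x y : 'End(V),
  [/\ x \in so_space f, y \in self_space f & A = x + y].
Proof.
suff /memv_addP[x xL [y yM ->]] : A \in (so_space f + self_space f)%VS.
  by exists x, y.
rewrite [A](end_decomp decomp); apply: rpred_sum => i _; apply: rpred_sum => j
  _.
apply: rpredZ; suff -> : rk1 f (e i) (e j) = 2^-1 *: (Y (-1) i j + Y 1 i j).
  by rewrite rpredZ // memv_add ?rks_so ?rks_self.
by rewrite !rks_def addrACA scaleN1r scale1r addNr addr0 -halve.
Qed.

(** The trace of [rks f (-1) u w] times y is f(w, y u) - f(u, y w), the failure of y to be
    self-adjoint at (u, w). All these operators lie in L(f), and they span it. *)
Lemma self_perp (y : 'End(V)) : y \in self_space f <->
  (forall x : 'End(V), x \in so_space f -> trace_form x y = 0).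
Proof.
have tr_rk x u w : trace_form (rk1 f u w) x = f w (x u).
  rewrite /trace_form /end_tr end_mx_comp ?vbasisP // mxtrace_mulC
    -end_mx_comp ?vbasisP //.
  suff -> : (x \o rk1 f u w)%VF = rk1 f (x u) w by exact: end_tr_rk1.
  by apply/lfunP => v; rewrite comp_lfunE !rk1E linearZ.
have tr_lin a (x x' z : 'End(V)) :
    trace_form (a *: x + x') z = a * trace_form x z + trace_form x' z.
  by rewrite /trace_form comp_lfunDl -comp_lfunZl linearP.
have tr_rks u w : trace_form (rks f (-1) u w) y = f w (y u) - f u (y w).
  by rewrite rks_def addrC tr_lin !tr_rk mulN1r addrC.
split=> [/mem_selfP yM x /mem_soP xL|y_perp].
  have x2 : 2 *: x = \sum_i \sum_j (f (e i) (x (e j)) / (d i * d j)) *: Y (-1)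
    i j.
    by apply: (end_decomp_sign decomp) => [v w|]; rewrite ?mulrNN ?mulr1 //
      mulN1r.
  have tr0 : trace_form 0 y = 0 by rewrite /trace_form comp_lfun0l linear0.
  have trZ a z : trace_form (a *: z) y = a * trace_form z y.
    by rewrite -[a *: z]addr0 tr_lin tr0 addr0.
  have trD z z' : trace_form z y = 0 -> trace_form z' y = 0 -> trace_form (z +
    z') y = 0.
    by move=> z0 z'0; rewrite -[z]scale1r tr_lin z0 z'0 mulr0 addr0.
  apply: (mulfI two_neq0); rewrite mulr0 -trZ x2.
  apply: (big_ind (fun z => trace_form z y = 0)) => // i _.
  apply: (big_ind (fun z => trace_form z y = 0)) => // j _.
  by rewrite trZ tr_rks (form_sym f (e j)) yM subrr mulr0.
apply/mem_selfP => v w; apply/eqP; rewrite form_sym -subr_eq0 -tr_rks.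
by rewrite y_perp ?rks_so.
Qed.

Definition tensor_end : 'Hom(tensor_sq V, 'End(V)) :=
  linfun (tensor_ext (rk1 f)).

Lemma tensor_end_tens u w : tensor_end (tens u w) = rk1 f u w.
Proof. by rewrite lfunE; apply: (tensor_ext_tens (rk1 f)). Qed.

Lemma tensor_end_act (x : subvs_of L) (t : tensor_mod V L) :
  tensor_end (act x t) = act x (tensor_end t : gl_mod L).
Proof.
rewrite -!comp_lfunE; congr (fun_of_lfun _ t); apply: tensor_lfunP => v w.
rewrite !comp_lfunE (tensor_act_tens x) linearD /= !tensor_end_tens.
by rewrite (gl_actE x) rk1_bracket // subvsP.
Qed.

Definition tensor_end_hom : modHom (tensor_mod V L) (gl_mod L) :=
  @ModHom _ _ _ (tensor_mod V L) (gl_mod L) tensor_end tensor_end_act.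

Lemma tensor_end_surj (A : 'End(V)) : exists t, tensor_end t = A.
Proof.
exists (\sum_i \sum_j (f (e i) (A (e j)) / (d i * d j)) *: tens (e i) (e j)).
rewrite [RHS](end_decomp decomp) linear_sum; apply: eq_bigr => i _.
by rewrite linear_sum; apply: eq_bigr => j _; rewrite linearZ /=
  tensor_end_tens.
Qed.

Lemma tensor_end_inj : injective tensor_end.
Proof.
apply/lker0P; rewrite -dimv_eq0.
have limg : limg tensor_end = fullv.
  apply/vspaceP => A; rewrite memvf; have [t <-] := tensor_end_surj A.
  by rewrite memv_img ?memvf.
have := limg_ker_dim tensor_end fullv; rewrite capfv limg !dimvf dim_matrix
  !dimvf.
by move=> dims; apply/eqP/(@addIn (dim V * dim V)%N); rewrite add0n; apply:
  dims.
Qed.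

(** The adjoint of v -> f(w, v) u exchanges u and w. *)
Lemma form_tensor_end t v w : f (tensor_end t v) w = f v (tensor_end (flip V
  t) w).
Proof.
pose b := vbasis {:V}.
have tE t' v' w' :
    f (tensor_end t' v') w' = \sum_i \sum_j t' i j * (f b`_j v' * f b`_i w').
  rewrite lfunE /= sum_lfunE linear_sumlz; apply: eq_bigr => i _.
  rewrite sum_lfunE linear_sumlz; apply: eq_bigr => j _.
  by rewrite scale_lfunE rk1E !linearZl_LR.
rewrite (form_sym f v) !tE exchange_big; apply: eq_bigr => i _.
by apply: eq_bigr => j _; rewrite lfunE mxE [f _ w * _]mulrC.
Qed.

Lemma tensor_end_self t : (tensor_end t \in self_space f) = (t \in sym2_space
  L).
Proof.
apply/mem_selfP/fixedSpaceP => [tM|ft v w]; last by rewrite form_tensor_end ft.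
apply: tensor_end_inj; apply: (end_eq_form decomp) => v w.
by rewrite form_sym -form_tensor_end tM form_sym.
Qed.

(** A tensor negated by the flip is half of t - [flip V t], and expanding t in the basis tensors
    writes this in the span. *)
Lemma ext2_spaceP t : (t \in ext2_space L) = (flip V t == - t).
Proof.
apply/idP/eqP => [|ft].
  suff : (ext2_space L <= lker (flip V + \1%VF)%R)%VS.
    move=> /subvP H /H; rewrite memv_ker add_lfunE id_lfunE addr_eq0.
    by move/eqP.
  apply/span_subvP => _ /allpairsP[[v w] /= [_ _ ->]].
  by rewrite memv_ker add_lfunE id_lfunE linearB /= !flip_tens addrC subrKA
    subrr.
rewrite [t]halve -{2}[t]opprK -ft {2}[t]tensor_basis {1}[t]tensor_basis.
rewrite linear_sum -sumrB; apply/rpredZ/rpred_sum => i _.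
rewrite linear_sum -sumrB; apply: rpred_sum => j _.
by rewrite linearZ /= -scalerBr rpredZ // flip_tens ext2_tens.
Qed.

Lemma tensor_end_so t : (tensor_end t \in so_space f) = (t \in ext2_space L).
Proof.
rewrite ext2_spaceP; apply/mem_soP/eqP => [tM|ft v w]; last first.
  by rewrite form_tensor_end ft linearN opp_lfunE linearNr.
apply: tensor_end_inj; apply: (end_eq_form decomp) => v w.
by rewrite form_sym -form_tensor_end tM linearN opp_lfunE linearNl form_sym.
Qed.

Lemma self_sub_iso : mod_isomorphic (sub_mod (self_sub f)) (sym2_mod V L).
Proof.
apply: mod_isomorphic_sym.
apply: (@mod_isomorphic_onto _ _ _ _ _ (comp_hom tensor_end_hom (incl
  (sym2_sub L)))).
  by move=> u v; rewrite !comp_lfunE !inclE => /tensor_end_inj/subvs_inj.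
move=> y; split=> [yM|[u <-]]; last first.
  by rewrite comp_lfunE inclE [_ \in _]tensor_end_self subvsP.
have [t ty] := tensor_end_surj y.
have tS : t \in sym2_space L by rewrite -tensor_end_self ty.
by exists (Subvs tS); rewrite comp_lfunE inclE.
Qed.

Lemma so_sub_iso_ext2 : mod_isomorphic (sub_mod (so_sub f)) (ext2_mod V L).
Proof.
apply: mod_isomorphic_sym.
apply: (@mod_isomorphic_onto _ _ _ _ _ (comp_hom tensor_end_hom (incl
  (ext2_sub L)))).
  by move=> u v; rewrite !comp_lfunE !inclE => /tensor_end_inj/subvs_inj.
move=> y; split=> [yM|[u <-]]; last first.
  by rewrite comp_lfunE inclE [_ \in _]tensor_end_so subvsP.
have [t ty] := tensor_end_surj y.
have tS : t \in ext2_space L by rewrite -tensor_end_so ty.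
by exists (Subvs tS); rewrite comp_lfunE inclE.
Qed.

(** L(f) is a stable complement of M(f), so the class map restricted to it is bijective. *)
Lemma so_sub_iso_quo : mod_isomorphic (sub_mod (so_sub f)) (quo_mod (self_sub
  f)).
Proof.
pose g : 'Hom(sub_mod (so_sub f), quo_mod (self_sub f)) :=
  (quo_class (self_sub f) \o incl (so_sub f))%VF.
have gE u : g u = quo_class (self_sub f) (vsval u) by rewrite comp_lfunE inclE.
have q0 A : quo_class (self_sub f) A = 0 <-> A \in self_space f.
  by apply: iff_trans (rwP eqP) _; rewrite -(quo_class_eq0 (self_sub f)).
have gA x u : g (act x u) = act x (g u).
  by rewrite !gE (vsval_sub_act x u) -(quo_act_class _ x (vsval u)).
exists (ModHom gA); apply: modHom_bij => /= [|c].
  apply/lker0P; rewrite -subv0; apply/subvP => u; rewrite memv_ker gE =>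
    /eqP/q0.
  move=> /(so_self_cap0 (subvsP u)) u0; rewrite memv0.
  by rewrite -(inj_eq (@subvs_inj _ _ _)) linear0 u0.
have [A ->] := @quo_class_surj _ _ _ _ (self_sub f) c; have [x [y [xL yM
  Axy]]] := so_self_decomp A.
by exists (Subvs xL); rewrite gE Axy linearD /= (q0 y).2 // addr0.
Qed.

(** The contraction is the trace read through [tensor_end]; its invariance is the vanishing of
    traces of brackets. *)
Definition contraction_fun : 'Hom(sym2_mod V L, F^o) :=
  (linfun (@end_tr F V : _ -> F^o) \o tensor_end \o incl (sym2_sub L))%VF.

Lemma contraction_funE u : contraction_fun u = end_tr (tensor_end (vsval u)).
Proof. by rewrite !comp_lfunE inclE lfunE. Qed.

Lemma contraction_act (x : subvs_of L) u :
  contraction_fun (act x u) = act x (contraction_fun u : triv_mod L).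
Proof.
rewrite [RHS]zero_lfunE contraction_funE (vsval_sub_act x u) tensor_end_act.
by rewrite gl_actE end_tr_bracket.
Qed.

Definition contraction : modHom (sym2_mod V L) (triv_mod L) :=
  @ModHom _ _ _ (sym2_mod V L) (triv_mod L) contraction_fun contraction_act.

Lemma contractionE u : contraction u = end_tr (tensor_end (vsval u)).
Proof. exact: contraction_funE. Qed.

Lemma contraction_sprod v w : contraction (sprod L v w) = f v w.
Proof.
rewrite contractionE.
have -> : tensor_end (vsval (sprod L v w)) = 2^-1 *: (rk1 f v w + rk1 f w v).
  by rewrite -!tensor_end_tens -linearD -linearZ.
rewrite linearZ linearD /= !end_tr_rk1 (form_sym f w).
by rewrite -mulr2n -[f v w *+ 2]mulr_natl mulKf.
Qed.

Lemma contraction_epi (i : I) : mod_epi contraction.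
Proof.
apply/vspaceP => a; rewrite memvf; apply/memv_imgP.
exists ((a / d i) *: sprod L (e i) (e i)); rewrite ?memvf //.
transitivity ((a / d i) * contraction (sprod L (e i) (e i))).
  by rewrite contraction_sprod orth eqxx mulr1n divfK.
by apply/esym; exact: linearZ.
Qed.

Lemma selfsl_sub_iso : mod_isomorphic (sub_mod (selfsl_sub f)) (sub_mod
  (ker_sub contraction)).
Proof.
apply: mod_isomorphic_sym.
pose g := comp_hom tensor_end_hom (comp_hom (incl (sym2_sub L)) (incl (ker_sub
  contraction))).
have gE u : g u = tensor_end (vsval (vsval u)).
  by rewrite !comp_lfunE !inclE.
apply: (@mod_isomorphic_onto _ _ _ _ _ g).
  by move=> u v; rewrite !gE => /tensor_end_inj/subvs_inj/subvs_inj.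
move=> y; rewrite memv_cap mem_sl; split=> [/andP[yM tr0]|[u <-]]; last first.
  have := subvsP u; rewrite memv_ker contractionE => /eqP u0.
  by rewrite gE tensor_end_self subvsP u0 eqxx.
have [t ty] := tensor_end_surj y.
have tS : t \in sym2_space L by rewrite -tensor_end_self ty.
have tK : Subvs tS \in lker contraction by rewrite memv_ker contractionE ty.
by exists (Subvs tK); rewrite gE.
Qed.

End TensorIso.

(** * Counting index pairs; divisibility by the characteristic *)

Lemma card_ltn_pairs m :
  #|[pred p : 'I_m * 'I_m | (p.1 < p.2)%N]| = 'C(m, 2).
Proof.
rewrite -sum1_card -(pair_big_dep predT (fun i j : 'I_m => (i < j)%N) (fun _ _
  => 1%N)) /=.
rewrite (exchange_big_dep predT) //= -bin2_sum big_mkord; apply: eq_bigr => j _.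
by rewrite (big_ord_narrow (ltnW (ltn_ord j))) sum1_card card_ord.
Qed.

Lemma card_leq_pairs m :
  #|[pred p : 'I_m * 'I_m | (p.1 <= p.2)%N]| = 'C(m.+1, 2).
Proof.
rewrite -sum1_card -(pair_big_dep predT (fun i j : 'I_m => (i <= j)%N) (fun _
  _ => 1%N)) /=.
rewrite (exchange_big_dep predT) //= -bin2_sum big_nat_recl // big_mkord add0n.
apply: eq_bigr => j _; rewrite (eq_bigl (fun i : 'I_m => (i < j.+1)%N)) //.
by rewrite (big_ord_narrow (ltn_ord j)) sum1_card card_ord.
Qed.

Lemma bin2_succD m : ('C(m.+1, 2) + 'C(m, 2) = m * m)%N.
Proof.
elim: m => // m IHm; rewrite binS bin1 addnAC addnC; move: IHm.
by rewrite binS bin1 => IHm; rewrite mulSn mulnS addnA -IHm; ring.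
Qed.

Lemma dvdn_characteristic (F : fieldType) l n :
  has_characteristic F l -> (l %| n)%N = (n%:R == 0 :> F).
Proof.
by case=> [[-> /pcharf0P->]|lF]; [rewrite dvd0n | apply: dvdn_pcharf].
Qed.

(** * Dimensions, irreducible factors and simplicity *)

Section Structure.
Variables (F : fieldType) (V : vectType F) (m : nat) (f : {symmetric V}).
Variables (e : 'I_m -> V) (d : 'I_m -> F).
Hypothesis orth : forall i j, f (e i) (e j) = d i *+ (i == j).
Hypothesis d_neq0 : forall i, d i != 0.
Hypothesis decomp : forall v, v = \sum_i (f (e i) v / d i) *: e i.
Hypothesis two_neq0 : 2 != 0 :> F.
Hypothesis dimV : \dim {:V} = m.
Hypothesis m_ge2 : (2 <= m)%N.

Local Notation L := (so_alg f).
Local Notation M := (self_sub f).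
Local Notation M0 := (selfsl_sub f).
Local Notation Sc := (scalar_sub f).
Local Notation Y s i j := (rks f s (e i) (e j)).

Let i0 : 'I_m := Ordinal (ltnW m_ge2).

(** The symmetrized operators indexed by i <= j, resp. i < j, span M(f), resp. L(f), which bounds
    both dimensions above. The bounds add up to m^2 = dim gl(V), so both are attained and no linear
    independence has to be checked. *)
Lemma dim_self_so :
  (\dim (self_space f) = 'C(m.+1, 2)) * (\dim (so_space f) = 'C(m, 2)).
Proof.
have Mle : (\dim (self_space f) <= 'C(m.+1, 2))%N.
  pose s := [seq Y 1 p.1 p.2 | p in [pred p : 'I_m * 'I_m | (p.1 <= p.2)%N]].
  rewrite -card_leq_pairs -(size_image (fun p => Y 1 p.1 p.2)).
  apply: leq_trans (dim_span s); apply/dimvS/subvP => A /mem_selfP AM.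
  apply: (stable_scale two_neq0); rewrite (@end_decomp_sign _ _ _ _ _ _ decomp
    1).
  - apply: rpred_sum => i _; apply: rpred_sum => j _; apply/rpredZ/memv_span.
    have [ij|/ltnW ji] := leqP i j.
      by rewrite (image_f (fun p => Y 1 p.1 p.2) (x := (i, j))).
    rewrite rksC ?mulr1 // scale1r.
    by rewrite (image_f (fun p => Y 1 p.1 p.2) (x := (j, i))).
  - by move=> v w; rewrite mul1r AM.
  by rewrite mulr1.
have Lle : (\dim (so_space f) <= 'C(m, 2))%N.
  pose s := [seq Y (-1) p.1 p.2 | p in [pred p : 'I_m * 'I_m | (p.1 < p.2)%N]].
  rewrite -card_ltn_pairs -(size_image (fun p => Y (-1) p.1 p.2)).
  apply: leq_trans (dim_span s); apply/dimvS/subvP => A /mem_soP AL.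
  have NN1 : -1 * -1 = 1 :> F by rewrite mulrNN mulr1.
  apply: (stable_scale two_neq0); rewrite (@end_decomp_sign _ _ _ _ _ _ decomp
    (-1)) //.
    apply: rpred_sum => i _; apply: rpred_sum => j _; apply/rpredZ.
    case: (ltngtP i j) => [ij|ji|/val_inj->].
    - by rewrite memv_span // (image_f (fun p => Y (-1) p.1 p.2) (x := (i, j))).
    - rewrite rksC // rpredZ // memv_span //.
      by rewrite (image_f (fun p => Y (-1) p.1 p.2) (x := (j, i))).
    by rewrite rks_def scaleN1r subrr mem0v.
  by move=> v w; rewrite mulN1r AL.
have dims : (\dim (self_space f) + \dim (so_space f) = 'C(m.+1, 2) + 'C(m,
  2))%N.
  rewrite addnC -dimv_disjoint_sum; last first.
    apply/eqP; rewrite -subv0; apply/subvP => A; rewrite memv_cap => /andP[AL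
      AM].
    by rewrite (so_self_cap0 decomp two_neq0 AL AM) mem0v.
  have -> : (so_space f + self_space f)%VS = fullv.
    apply/vspaceP => A; rewrite memvf.
    have [x [y [xL yM ->]]] := so_self_decomp decomp two_neq0 A.
    exact: memv_add.
  by rewrite bin2_succD dimvf -dimV !dimvf.
split; apply/eqP; rewrite eqn_leq ?Mle ?Lle /=.
  by rewrite -(leq_add2r 'C(m, 2)) -dims leq_add2l.
by rewrite -(leq_add2l 'C(m.+1, 2)) -dims leq_add2r.
Qed.

Lemma end_tr_rks i j : end_tr (Y 1 i j) = 2 * f (e i) (e j).
Proof.
rewrite rks_def scale1r linearD /= !end_tr_rk1 (form_sym f (e j)).
by rewrite -mulr2n mulr_natl.
Qed.

(** Rank-nullity for the trace on M(f), which is nonzero: [Y 1 i0 i0] has trace 2 d_i0. *)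
Lemma dim_self : \dim M = (\dim M0).+1.
Proof.
rewrite -(limg_ker_dim (linfun (@end_tr F V : _ -> F^o)) M) /= -addn1; congr
  (_ + _)%N.
apply/eqP; rewrite eqn_leq -{1}[1%N](dimvf (F^o : vectType F)) dimvS ?subvf //.
rewrite lt0n dimv_eq0; apply/eqP => im0.
have : linfun (@end_tr F V : _ -> F^o) (Y 1 i0 i0) \in 0%VS.
  by rewrite -im0 memv_img // rks_self.
rewrite memv0 lfunE /= end_tr_rks orth eqxx mulr1n mulf_eq0.
by rewrite (negPf two_neq0) (negPf (d_neq0 i0)).
Qed.

Lemma dim_selfsl : \dim M0 = ('C(m.+1, 2) - 1)%N.
Proof. by rewrite -dim_self_so -/(\dim M) dim_self subn1. Qed.

Lemma selfsl_subset : (M0 <= M)%VS.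
Proof. exact: capvSl. Qed.

Lemma id_neq0 : \1%VF != 0 :> 'End(V).
Proof.
apply/eqP => /lfunP/(_ (e i0)); rewrite id_lfunE zero_lfunE => e0.
by have /eqP := orth i0 i0; rewrite e0 linear0l eqxx mulr1n eq_sym (negPf
  (d_neq0 _)).
Qed.

Lemma end_tr_id : end_tr (\1%VF : 'End(V)) = m%:R.
Proof.
rewrite (end_tr_basis orth d_neq0 decomp).
under eq_bigr do rewrite id_lfunE orth eqxx mulr1n divff //.
by rewrite sumr_const card_ord.
Qed.

Lemma dim_scalar : \dim Sc = 1%N.
Proof. by rewrite dim_vline id_neq0. Qed.

Lemma scalar_selfsl : m%:R = 0 :> F -> (Sc <= M0)%VS.
Proof.
move=> m0; rewrite -memvE memv_cap mem_sl end_tr_id m0 eqxx andbT.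
by apply/mem_selfP => v w; rewrite !id_lfunE.
Qed.

Lemma stable_so_gl (S : {vspace gl_mod L}) : stable S ->
  forall x y, x \in so_space f -> y \in S -> lie_bracket x y \in S.
Proof. by move=> Sst x y xL yS; have := Sst (Subvs xL) y yS; rewrite gl_actE.
  Qed.

Lemma stable_selfsl_cases (S : {vspace gl_mod L}) : (4 <= m)%N -> stable S ->
  (S <= M0)%VS -> (S <= Sc)%VS \/ S = M0.
Proof.
move=> m4 Sst SM0; have [|/subvPn[A AS nA]] := boolP (S <= Sc)%VS; [by
  left|right].
have AM : A \in self_space f by have := subvP SM0 A AS; rewrite memv_cap =>
  /andP[].
apply/eqP; rewrite eqEsubv SM0.
apply: (stable_selfsl orth d_neq0 decomp two_neq0 (stable_so_gl Sst) _ AM) =>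
  //.
by rewrite card_ord.
Qed.

(** The scalar k has trace k m, so only zero is both scalar and traceless. The second form, over the
    zero submodule, is the one that composition series ask for. *)
Lemma selfsl_irreducible : (4 <= m)%N -> m%:R != 0 :> F ->
  irreducible_mod (sub_mod M0) /\ irreducible_mod (subquo M0 (zero_sub :
    submodule (gl_mod L))).
Proof.
move=> m4 m0.
have M00 : M0 <> 0%VS :> {vspace _}.
  apply/eqP; rewrite -dimv_eq0 dim_selfsl subn_eq0 -ltnNge.
  by apply: leq_trans (leq_bin2l 2 (m4 : 5 <= m.+1)%N).
have irr (S : {vspace gl_mod L}) : stable S -> (S <= M0)%VS -> S = 0%VS \/ S =
  M0.
  move=> Sst SM0; have [SSc|] := stable_selfsl_cases m4 Sst SM0; [left|by
    right].
  apply/eqP; rewrite -subv0; apply/subvP => A AS; rewrite memv0.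
  have := subvP SM0 A AS; rewrite memv_cap mem_sl => /andP[_].
  have /vlineP[k ->] := subvP SSc A AS.
  by rewrite linearZ /= end_tr_id mulf_eq0 (negPf m0) orbF => /eqP->; rewrite
    scale0r.
split; first exact: sub_mod_irreducible.
apply: subquo_irreducible => [||S Sst _ SM0]; [exact: sub0v|
  exact/nesym|exact: irr].
Qed.

Lemma selfsl_quo_irreducible : (4 <= m)%N -> m%:R = 0 :> F ->
  irreducible_mod (subquo M0 Sc).
Proof.
move=> m4 m0; apply: subquo_irreducible => [||S Sst ScS SM0].
- exact: scalar_selfsl.
(* Equality would force C(m+1, 2) - 1 = 1, while C(m+1, 2) is at least C(5, 2) = 10. *)
- move=> /(congr1 (fun W : {vspace _} => \dim W)); rewrite dim_scalar
  dim_selfsl => /eqP.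
  by have := leq_bin2l 2 (m4 : 5 <= m.+1)%N; case: 'C(m.+1, _) => [|[|[|]]].
have [SSc|] := stable_selfsl_cases m4 Sst SM0; [left|by right].
by apply/eqP; rewrite eqEsubv SSc.
Qed.

(** Viewed in gl(V), an ideal of L(f) is a subspace of L(f) stable under brackets with L(f), so
    [stable_so] applies. *)
Lemma so_simple : m = 3%N \/ (5 <= m)%N -> lie_simple L.
Proof.
move=> m35; split.
  rewrite dimvf -[X in (_ < X)%N]/(\dim (so_space f)) dim_self_so.
  have m3 : (3 <= m)%N by case: m35 => [->|/ltnW/ltnW].
  by apply: leq_trans (leq_bin2l 2 m3).
move=> I Iid; pose S := (linfun (vsval : subvs_of L -> 'End(V)) @: I)%VS.
have memS (u : subvs_of L) : (vsval u \in S) = (u \in I).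
  apply/idP/idP => [/memv_imgP[v vI]|uI].
    by rewrite lfunE /= => /subvs_inj ->.
  by apply/memv_imgP; exists u; rewrite ?lfunE.
have Sso : (S <= so_space f)%VS.
  by apply/subvP => _ /memv_imgP[v _ ->]; rewrite lfunE subvsP.
have Sst x y : x \in so_space f -> y \in S -> lie_bracket x y \in S.
  move=> xL /memv_imgP[v vI ->]; rewrite lfunE /=.
  rewrite -[lie_bracket x _]/(vsval (lie_mul (Subvs xL : subvs_of L) v)) memS.
  exact: Iid.
have [S0|[A AS A0]] : S = 0%VS \/ exists2 A, A \in S & A != 0.
- have [->|S0] := eqVneq S 0%VS; [by left|right].
  by exists (vpick S); rewrite ?memv_pick ?vpick0.
- left; apply/vspaceP => u.
  by rewrite -memS S0 !memv0 -(inj_eq (@subvs_inj _ _ _)) linear0.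
right; apply/vspaceP => u; rewrite memvf -memS.
rewrite (stable_so orth d_neq0 decomp two_neq0 Sst _ Sso AS A0) ?subvsP //.
by rewrite card_ord.
Qed.

(** For S between M(f) and gl(V), the intersection of S with L(f) is an ideal. As gl(V) = L(f) +
    M(f), S is M(f) if this ideal is zero and gl(V) if it is L(f). *)
Lemma gl_quo_irreducible : lie_simple L ->
  irreducible_mod (subquo (full_sub : submodule (gl_mod L)) M).
Proof.
case=> dimL Lsimple; apply: subquo_irreducible => [||S Sst MS _].
- exact: subvf.
- move=> MV; move: dimL; suff -> : \dim {:subvs_of L} = 0%N by [].
  rewrite dimvf -[LHS]/(\dim (so_space f)); apply/eqP; rewrite dimv_eq0 -subv0.
  apply/subvP => A AL; rewrite memv0; apply/eqP.
  apply: (so_self_cap0 decomp two_neq0 AL).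
  by rewrite -[_ \in _]/(A \in (M : {vspace _})) MV memvf.
pose I := (linfun (vsval : subvs_of L -> 'End(V)) @^-1: S)%VS.
have memI (u : subvs_of L) : (u \in I) = (vsval u \in S) by rewrite
  -memv_preim lfunE.
have Iid : lie_ideal I.
  by move=> x y; rewrite !memI => yS; have := Sst x _ yS; rewrite gl_actE.
have [I0|I1] := Lsimple I Iid; [left|right]; apply/vspaceP => A.
  apply/idP/idP => [AS|]; last exact: (subvP MS).
  have [x [y [xL yM Axy]]] := so_self_decomp decomp two_neq0 A.
  have : (Subvs xL : subvs_of L) \in I.
    by rewrite memI /= -[x](addrK y) -Axy rpredB // (subvP MS).
  rewrite I0 memv0 Axy -[x]/(vsval (Subvs xL : subvs_of L)) => /eqP->.
  by rewrite linear0 add0r.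
rewrite memvf; have [x [y [xL yM ->]]] := so_self_decomp decomp two_neq0 A.
apply: rpredD; last exact: (subvP MS).
by rewrite -[x]/(vsval (Subvs xL : subvs_of L)) -memI I1 memvf.
Qed.

(** Brackets are traceless, so L(f) maps M(f) into its traceless part. *)
Lemma self_selfsl_trivial : trivial_mod (subquo M M0).
Proof.
split=> [|x c]; first by rewrite dim_subquo ?selfsl_subset // dim_self subSnn.
have [u ->] := @quo_class_surj _ _ _ _ (sub_restr M M0) c.
apply: etrans (quo_act_class _ x u) _; apply/eqP; rewrite quo_class_eq0.
rewrite [_ \in _]mem_sub_restr (vsval_sub_act x u) gl_actE memv_cap mem_sl.
rewrite end_tr_bracket eqxx andbT -gl_actE.
exact: (@self_stable _ _ f x (vsval u) (subvsP u)).
Qed.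

End Structure.

(** * Diagonalizing a nondegenerate form, and assembling the theorem *)

Lemma orthogonal_frame (F : fieldType) (V : vectType F) (m : nat) (f :
  {symmetric V}) :
  2 != 0 :> F -> \dim {:V} = m -> nondegenerate f ->
  exists (e : m.-tuple V) (d : 'I_m -> F),
    [/\ basis_of {:V} e,
        forall i j : 'I_m, f e`_i e`_j = d i *+ (i == j),
        forall i, d i != 0,
        forall (i : 'I_m) v, f e`_i v = d i * coord e i v
      & forall v, v = \sum_(i < m) (f e`_i v / d i) *: e`_i].
Proof.
move=> two_neq0 <- fnd; have [e [eB eo]] := orthogonal_basis f two_neq0.
pose d (i : 'I_(\dim {:V})) := f e`_i e`_i; exists e, d.
have orth (i j : 'I_(\dim {:V})) : f e`_i e`_j = d i *+ (i == j).
  by have [->|/eo//] := eqVneq i j.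
have fe (i : 'I_(\dim {:V})) v : f e`_i v = d i * coord e i v.
  rewrite {1}(coord_basis eB (memvf v)) form_sumr (bigD1 i) //= big1.
    by rewrite orth eqxx addr0 mulrC.
  by move=> j /negPf ji; rewrite orth eq_sym ji mulr0.
(* Otherwise e_i would be orthogonal to all of V, against nondegeneracy. *)
have d0 i : d i != 0.
  apply/eqP => di0; have : e`_i \in orthov f fullv.
    by apply/mem_orthovP => v _; rewrite fe di0 mul0r.
  rewrite (eqP fnd) memv0 => /eqP ei0.
  have := coord_free i i (basis_free eB); rewrite ei0 linear0 eqxx => /eqP.
  by rewrite eq_sym oner_eq0.
split=> // v; rewrite {1}(coord_basis eB (memvf v)); apply: eq_bigr => i _.
by rewrite fe mulrC mulKf.
Qed.

Theorem theorem1p4 (F : fieldType) (l : nat) (V : vectType F) (m : nat)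
    (f : {symmetric V}) :
  has_characteristic F l -> l <> 2%N ->
  \dim {:V} = m -> (2 <= m)%N ->
  nondegenerate f ->
  (forall y : 'End(V), y \in self_space f <->
     (forall x : 'End(V), x \in so_space f -> trace_form x y = 0)) /\
  (exists (e : m.-tuple V) (d : 'rV[F]_m),
     [/\ basis_of {:V} e,
         gram_mx f e = diag_mx d,
         forall y : 'End(V), y \in self_space f <->
           (forall i j, d 0 i * end_mx e y i j = d 0 j * end_mx e y j i)
       & forall y : 'End(V), y \in (self_space f :&: sl_space V)%VS <->
           (forall i j, d 0 i * end_mx e y i j = d 0 j * end_mx e y j i) /\
           \tr (end_mx e y) = 0]) /\
  mod_isomorphic (sub_mod (self_sub f)) (sym2_mod V (so_alg f)) /\
  (exists c : modHom (sym2_mod V (so_alg f)) (triv_mod (so_alg f)),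
     [/\ forall v w : V, c (sprod (so_alg f) v w) = f v w,
         mod_epi c
       & mod_isomorphic (sub_mod (selfsl_sub f)) (sub_mod (ker_sub c))]) /\
  ((4 <= m)%N -> ~~ (l %| m)%N ->
     irreducible_mod (sub_mod (selfsl_sub f)) /\
     \dim {:sub_mod (selfsl_sub f)} = ('C(m.+1, 2) - 1)%N) /\
  ((4 <= m)%N -> (l %| m)%N ->
     irreducible_mod (subquo (selfsl_sub f) (scalar_sub f)) /\
     \dim {:subquo (selfsl_sub f) (scalar_sub f)} = ('C(m.+1, 2) - 2)%N) /\
  (m = 3%N \/ (5 <= m)%N ->
     [/\ lie_simple (so_alg f),
         mod_isomorphic (sub_mod (so_sub f)) (quo_mod (self_sub f))
       & mod_isomorphic (sub_mod (so_sub f)) (ext2_mod V (so_alg f))]) /\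
  ((4 <= m)%N -> (l %| m)%N ->
     composition_series
       [:: zero_sub; scalar_sub f; selfsl_sub f; self_sub f; full_sub]) /\
  (* When m = 4, L(f) need not be simple, and then the factor gl(V) / M(f),   *)
  (* isomorphic to L(f), is reducible.                                        *)
  ((4 <= m)%N -> ~~ (l %| m)%N ->
     comp_chain zero_sub [:: selfsl_sub f; self_sub f] /\
     ((m = 4%N -> lie_simple (so_alg f)) ->
        composition_series
          [:: zero_sub; selfsl_sub f; self_sub f; full_sub])) /\
  trivial_mod (subquo (self_sub f) (selfsl_sub f)).
Proof.
move=> Fl l2 dimV m2 fnd.
have two_neq0 : 2 != 0 :> F.
  rewrite -(dvdn_characteristic 2 Fl); case: Fl => [[-> _]//|lF].
  rewrite dvdn_prime2 ?(pcharf_prime lF) //; exact/eqP.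
have [e [d [eB orth d_neq0 fe decomp]]] := orthogonal_frame two_neq0 dimV fnd.
pose i0 : 'I_m := Ordinal (ltnW m2).
(* Since d_i A_ij = f(e_i, A e_j), the matrix condition is self-adjointness on basis vectors. *)
have selfP (y : 'End(V)) : y \in self_space f <->
    (forall i j, d i * end_mx e y i j = d j * end_mx e y j i).
  split=> [/mem_selfP yM i j|y_sym]; first by rewrite !mxE -!fe -yM form_sym.
  apply/mem_selfP => v w; rewrite [v]decomp [w]decomp !(linear_sum y) /=.
  rewrite !linear_sumlz; apply: eq_bigr => i _.
  rewrite !linear_sumr; apply: eq_bigr => j _.
  rewrite ![y (_ *: _)]linearZ /= !linearZl_LR !linearZr_LR /=. congr (_ * (_
    * _)).
  by rewrite form_sym !fe; have := y_sym j i; rewrite !mxE.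
have trE (y : 'End(V)) : \tr (end_mx e y) = end_tr y.
  rewrite (end_tr_basis orth d_neq0 decomp); apply: eq_bigr => i _.
  by rewrite mxE fe mulrC mulKf.
split; first exact: self_perp decomp two_neq0.
split.
  exists e, (\row_i d i); split=> //.
  - by apply/matrixP => i j; rewrite !mxE orth.
  - move=> y; apply: iff_trans (selfP y) _.
    by split=> h i j; have := h i j; rewrite !mxE.
  move=> y; rewrite memv_cap mem_sl trE; split=> [/andP[/selfP h /eqP ->]|[h
    ->]].
    by split=> // i j; have := h i j; rewrite !mxE.
  by rewrite eqxx andbT; apply/selfP => i j; have := h i j; rewrite !mxE.
split; first exact: self_sub_iso decomp.
split.
  exists (contraction f); split.
  - exact: contraction_sprod.
  - exact: contraction_epi orth d_neq0 two_neq0 i0.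
  exact: selfsl_sub_iso decomp.
have dS : \dim (scalar_space V) = 1%N.
  exact: (dim_scalar orth d_neq0 m2).
have selfsl_lt : \dim (self_sub f) = (\dim (selfsl_sub f)).+1.
  exact: dim_self orth d_neq0 two_neq0 m2.
have dM0 : \dim (selfsl_sub f) = ('C(m.+1, 2) - 1)%N.
  exact: (dim_selfsl orth d_neq0 decomp two_neq0 dimV m2).
have simple35 : m = 3%N \/ (5 <= m)%N -> lie_simple (so_alg f).
  exact: so_simple orth d_neq0 decomp two_neq0 dimV.
have M_irr : irreducible_mod (subquo (self_sub f) (selfsl_sub f)).
  by apply: line_irreducible; rewrite ?selfsl_lt ?selfsl_subset.
have gl_irr := gl_quo_irreducible decomp two_neq0.
split.
  move=> m4 lm; rewrite (dvdn_characteristic m Fl) in lm.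
  have [? _] := selfsl_irreducible orth d_neq0 decomp two_neq0 dimV m2 m4 lm.
  by split; rewrite ?dim_sub_mod.
split.
  move=> m4; rewrite (dvdn_characteristic m Fl) => /eqP lm.
  split; first exact: (selfsl_quo_irreducible orth d_neq0 decomp two_neq0 dimV
    m2 m4 lm).
  rewrite dim_subquo; last exact: (scalar_selfsl orth d_neq0 decomp lm).
  by rewrite dM0 dS -subnDA.
split.
  move=> m35; split; first exact: simple35.
  - exact: so_sub_iso_quo decomp two_neq0.
  exact: so_sub_iso_ext2 decomp two_neq0.
split.
  (* The case m = 4 is excluded: 0 does not divide 4, and a prime dividing 4 is 2. Hence L(f) is
     simple here. *)
  move=> m4 lm; have m5 : (5 <= m)%N.
    rewrite ltn_neqAle m4 andbT; apply: contra_not_neq l2 => m4'.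
    case: Fl lm => [[-> _]|lF]; rewrite -m4' ?dvd0n //.
    rewrite -[4%N]/(2 ^ 2)%N Euclid_dvdX ?(pcharf_prime lF) // andbT.
    by rewrite dvdn_prime2 ?(pcharf_prime lF) // => /eqP.
  have Ls := simple35 (or_intror m5).
  have m0 : m%:R = 0 :> F by apply/eqP; rewrite -(dvdn_characteristic m Fl).
  have ScM0 := scalar_selfsl orth d_neq0 decomp m0.
  split=> //; apply: comp_chain_cons; first exact: sub0v.
    by apply: line_irreducible; rewrite ?sub0v ?dimv0.
  apply: comp_chain_cons; first exact: ScM0.
    exact: (selfsl_quo_irreducible orth d_neq0 decomp two_neq0 dimV m2 m4 m0).
  apply: comp_chain_cons; [exact: selfsl_subset|exact: M_irr|].
  by apply: comp_chain_cons; [exact: subvf|exact: gl_irr|].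
split; last exact: self_selfsl_trivial orth d_neq0 two_neq0 m2.
move=> m4 lm; rewrite (dvdn_characteristic m Fl) in lm.
have [_ irr] := selfsl_irreducible orth d_neq0 decomp two_neq0 dimV m2 m4 lm.
split=> [|L4].
  apply: comp_chain_cons; [exact: sub0v|exact: irr|].
  by apply: comp_chain_cons; [exact: selfsl_subset|exact: M_irr|].
(* Simplicity is proved for m at least 5 and is the hypothesis [L4] for m = 4. *)
have Ls : lie_simple (so_alg f).
  by move: m4; rewrite leq_eqVlt => /orP[/eqP/esym/L4//|m5]; apply: simple35;
    right.
split=> //; apply: comp_chain_cons; [exact: sub0v|exact: irr|].
apply: comp_chain_cons; [exact: selfsl_subset|exact: M_irr|].
by apply: comp_chain_cons; [exact: subvf|exact: gl_irr|].
Qed.
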